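(* Let $|v|<1$. Suppose $u$ on $\mathbb{R}^3\times\mathbb{R}$ solves $$\partial_{tt}u-\Delta u+V(x,t)u=0$$ and $$|V(x,\mu x_1)|\lesssim\frac{1}{\langle x\rangle^2}\quad\text{uniformly for }0\le|\mu|\le|v|<1 .$$ Then $$\int_{\mathbb{R}^3}|\nabla_xu(x_1,x_2,x_3,vx_1)|^2+|\partial_tu(x_1,x_2,x_3,vx_1)|^2\,dx\simeq\int_{\mathbb{R}^3}|\nabla_xu(x_1,x_2,x_3,0)|^2+|\partial_tu(x_1,x_2,x_3,0)|^2\,dx,$$ where the implicit constants depend on $v$ and $V$.
   Context: $x=(x_1,x_2,x_3)$, $\langle x\rangle=(1+|x|^2)^{1/2}$. The expressions $\nabla_xu(x_1,x_2,x_3,vx_1)$ and $\partial_tu(x_1,x_2,x_3,vx_1)$ mean the partial derivatives $\nabla_xu(x,t)$, $\partial_tu(x,t)$ evaluated at $t=vx_1$. $a\simeq b$ means $a\lesssim b$ and $b\lesssim a$. Standing assumption: all functions are smooth and decay fast, the constants being independent of this additional regularity. *)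

(* Defs.v *)
From HB Require Import structures.
From mathcomp Require Import all_boot all_order all_algebra.
From mathcomp Require Import all_classical all_reals all_analysis.
Set Implicit Arguments.
Unset Strict Implicit.
Unset Printing Implicit Defensive.
Import Order.TTheory GRing.Theory Num.Theory.
Import numFieldNormedType.Exports.
Local Open Scope classical_set_scope.
Local Open Scope ring_scope.

Notation R3 R := (R * R * R)%type (only parsing).
Notation spacetime R := (R * R * R * R)%type (only parsing).

Section Defs.
Variable R : realType.
Implicit Types (x : R3 R) (f u V : spacetime R -> R).

Definition coord1 x : R := x.1.1.
Definition coord2 x : R := x.1.2.
Definition coord3 x : R := x.2.

(* The norm carried by the product type is the sup norm, hence the explicit
   Euclidean norm here. *)
Definition japanese x : R :=
  Num.sqrt (1 + (coord1 x ^+ 2 + coord2 x ^+ 2 + coord3 x ^+ 2)).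

Inductive direction := dir_x1 | dir_x2 | dir_x3 | dir_t.

Definition dirvec (d : direction) : spacetime R :=
  match d with
  | dir_x1 => (1, 0, 0, 0)
  | dir_x2 => (0, 1, 0, 0)
  | dir_x3 => (0, 0, 1, 0)
  | dir_t  => (0, 0, 0, 1)
  end.

Definition partial (d : direction) f : spacetime R -> R :=
  fun z => 'D_(dirvec d) f z.

Definition partials (ds : seq direction) f : spacetime R -> R :=
  foldr partial f ds.

(* 'D_v f is total, so smoothness has to assert differentiability (here in the
   sense of Frechet) of every iterated partial derivative; this is C^oo. *)
Definition smooth f : Prop :=
  forall (ds : seq direction) (z : spacetime R), differentiable (partials ds f) z.

(* Every derivative decays in x faster than any power of <x>, locally
   uniformly in t. Decay in t is not required: a solution of a wave equation
   does not decay fast along the light cone. *)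
Definition fast_decay f : Prop :=
  forall (ds : seq direction) (N : nat) (T : R), exists C : R,
    forall x (t : R), `|t| <= T ->
      `|partials ds f (x, t)| <= C / japanese x ^+ N.

Definition laplacian f : spacetime R -> R := fun z =>
  partial dir_x1 (partial dir_x1 f) z + partial dir_x2 (partial dir_x2 f) z
  + partial dir_x3 (partial dir_x3 f) z.

Definition solves_wave V u : Prop := forall z : spacetime R,
  partial dir_t (partial dir_t u) z - laplacian u z + V z * u z = 0.

Definition sqnorm_grad u : spacetime R -> R := fun z =>
  partial dir_x1 u z ^+ 2 + partial dir_x2 u z ^+ 2 + partial dir_x3 u z ^+ 2.

Local Notation mu := (@lebesgue_measure R).

(* The integrand is nonnegative, so this integral always makes sense in
   [0, +oo]. *)
Definition slanted_energy (v : R) u : \bar R :=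
  (\int[(mu \x mu) \x mu]_x
     (sqnorm_grad u (x, (v * coord1 x)%R)
      + partial dir_t u (x, (v * coord1 x)%R) ^+ 2)%R%:E)%E.

End Defs.

(* Main.v *)
Require Import Defs.
From HB Require Import structures.
From mathcomp Require Import all_boot all_order all_algebra.
From mathcomp Require Import all_classical all_reals all_analysis.
From mathcomp Require Import measurable_realfun ring lra.
Import Order.TTheory GRing.Theory Num.Theory.
Import numFieldNormedType.Exports.
Local Open Scope classical_set_scope.
Local Open Scope ring_scope.

(* Foliate the region between [t = 0] and [t = v x1] by the surfaces
   [t = m x1], [|m| <= |v|].  As [|m| < 1] these are uniformly spacelike, so the
   energy flux through them is comparable to the energy, and its derivative in
   [m] is [- int x1 V u u_t], which is bounded by the energy because of the decay
   of [V] and Hardy's inequality with the weight [<x>^-2].  Gronwall's lemma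
   concludes.

   The decay of [u] is only locally uniform in [t], so nothing is known a priori
   on the slanted surfaces.  The argument is therefore run on [t = m phi(x1)]
   with [phi] bounded, [phi(s) = s] for [|s| <= n], [|phi(s)| <= |s|] and
   [|phi'| <= 1], with constants independent of [n]; the same estimate with the
   additional weight [1 + x1^2] shows that the energy on [t = v phi(x1)] does not
   escape to [|x1| >= n], which allows to let [n] tend to infinity. *)

(** * Lebesgue measure on R^3 *)

(** Hardy's inequality is needed on the slanted surfaces themselves, that is with the tangential
    derivative [u_1 + m psi u_t]. It is never stated as an integral inequality: Hardy's inequality
    and the energy identity are both proved pointwise, modulo divergences of rapidly decreasing
    fields, so that a single integration over R^3 closes the estimate. The Hardy field has
    [1 + |x|^2] in the denominator, which avoids the singularity at the origin. The bound |phi(s)|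
    <= |s| keeps the surfaces inside |t| <= |v x1|, where the decay of V is assumed, and |phi'| <= 1
    keeps them spacelike with the same margin 1 - |v|; this is why no constant sees n. The two
    directions differ. Bounding the slanted energy from above only takes monotone convergence. The
    converse needs the weight: the tail of a truncated surface is not controlled by the slanted
    energy, which a priori may even be infinite. The final constant is 2 / (1 - |v|), from
    coercivity of the flux, times the Gronwall exponential over an interval of slopes of length at
    most 1. *)

Section plane_measure.
Context {R : realType}.
Local Notation mu := (@lebesgue_measure R).
Local Notation TR := (measurableTypeR R).

(* A name of its own, since the canonical sigma-finite structure on [m1 \x m2]
   is the one for subprobabilities. *)
Definition lebesgue2 : set (TR * TR)%type -> \bar R := (mu \x mu)%E.

HB.instance Definition _ := Measure.on lebesgue2.

Lemma lebesgue2_sigma_finite : sigma_finite setT lebesgue2.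
Proof.
pose I (n : nat) : set TR := [set` `[- n%:R, n%:R : R]].
exists (fun n => I n `*` I n).
- apply/seteqP; split=> // -[x y] _.
  exists (Num.truncn (`|x| + `|y|)).+1 => //.
  have := truncnS_gt (`|x| + `|y|).
  have := normr_ge0 x; have := normr_ge0 y.
  by rewrite /I/= !in_itv/= -!ler_norml; split; lra.
- move=> n; have mI : measurable (I n) by exact: measurable_itv.
  have muI : (mu (I n) < +oo)%E.
    by rewrite /I lebesgue_measure_itv; case: ifP => _; rewrite ?ltry.
  split; first exact: measurableX.
  by rewrite [ltLHS]product_measure1E// lte_mul_pinfty// ge0_fin_numE.
Qed.

HB.instance Definition _ :=
  Measure_isSigmaFinite.Build _ _ _ lebesgue2 lebesgue2_sigma_finite.

(** Convertible to the measure [(mu \x mu) \x mu] of [slanted_energy], so that passing between the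
    two is a mere conversion. *)
Definition lebesgue3 : {measure set (TR * TR * TR)%type -> \bar R} :=
  [the measure _ _ of (lebesgue2 \x mu)%E].

End plane_measure.

Section continuous_measurable.
Context {R : realType}.
Local Notation mu := (@lebesgue_measure R).
Local Notation TR := (measurableTypeR R).

(** The sigma-algebra of the product is generated by rectangles, so an open set has to be exhibited
    as a countable union of them: the boxes with rational endpoints that it contains. *)
Lemma open_measurable3 (U : set (R * R * R)) : open U ->
  measurable (U : set (TR * TR * TR)%type).
Proof.
move=> oU.
pose I (q : rat * rat) : set TR := [set` `]ratr q.1, ratr q.2[ : interval R].
pose box (q : (rat * rat) * (rat * rat) * (rat * rat)) : set (TR * TR * TR)%type
  :=
  I q.1.1 `*` I q.1.2 `*` I q.2.
have mbox q : measurable (box q).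
  by apply: measurableX; [apply: measurableX|]; exact: measurable_itv.
have -> : (U : set (TR * TR * TR)%type) =
    \bigcup_q (if `[< box q `<=` U >] then box q else set0).
  apply/seteqP; split=> [[[x1 x2] x3] Ux|x [q _]]; last first.
    by case: ifPn => // /asboolP; apply.
  have : nbhs (x1, x2, x3) U by exact: open_nbhs_nbhs.
  move=> /nbhs_ballP[e /= e0 eU].
  have Irat (x : R) : exists q : rat * rat, I q x /\ (I q `<=` ball x e).
    have [q] := rat_in_itvoo (y := x) (x := x - e) ltac:(lra).
    rewrite in_itv/= => /andP[q1 q2].
    have [r] := rat_in_itvoo (y := x + e) (x := x) ltac:(lra).
    rewrite in_itv/= => /andP[r1 r2].
    exists (q, r); split; first by rewrite /I/= in_itv/= q2 r1.
    move=> y; rewrite /I/= in_itv/= => /andP[qy yr].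
    by rewrite /ball/= ltr_norml; lra.
  have [q1 [q1x q1e]] := Irat x1; have [q2 [q2x q2e]] := Irat x2.
  have [q3 [q3x q3e]] := Irat x3.
  exists (q1, q2, q3) => //; case: ifPn => // /asboolP; apply.
  move=> [[y1 y2] y3] [[/= y1q y2q] y3q]; apply: eU; split => /=.
    by split; [exact: q1e|exact: q2e].
  exact: q3e.
apply: countable_bigcupT_measurable => [|q]; first exact: countableP.
by case: ifPn.
Qed.

Lemma continuous_measurable_fun3 (f : R * R * R -> R) : continuous f ->
  measurable_fun (setT : set (TR * TR * TR)%type) f.
Proof.
move=> /continuousP cf; apply: (measurability _ (RGenOpens.measurableE R)).
move=> _ [_ [a [b ->] <-]]; rewrite setTI; apply: open_measurable3.
exact/cf/interval_open.
Qed.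

End continuous_measurable.

Section integrable_mul_prod.
Context {d1 d2} {T1 : measurableType d1} {T2 : measurableType d2} {R : realType}.
Variable m1 : {sigma_finite_measure set T1 -> \bar R}.
Variable m2 : {sigma_finite_measure set T2 -> \bar R}.

Lemma integrable_mul_prod (f : T1 -> R) (g : T2 -> R) :
  m1.-integrable setT (EFin \o f) -> m2.-integrable setT (EFin \o g) ->
  (m1 \x m2)%E.-integrable setT (fun z => (f z.1 * g z.2)%:E).
Proof.
move=> intf intg.
have /measurable_EFinP mf := measurable_int _ intf.
have /measurable_EFinP mg := measurable_int _ intg.
apply/integrable12ltyP.
  apply/measurable_EFinP/measurable_funM.
    exact: (measurableT_comp mf measurable_fst).
  exact: (measurableT_comp mg measurable_snd).
under eq_integral do under eq_integral do rewrite /= normrM EFinM.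
have mag : measurable_fun setT (fun y => `|g y|%:E).
  by apply/measurable_EFinP; exact: measurableT_comp.
have maf : measurable_fun setT (fun y => `|f y|%:E).
  by apply/measurable_EFinP; exact: measurableT_comp.
under eq_integral do rewrite ge0_integralZl ?lee_fin//.
have [_ fy] := integrableP _ _ _ intf.
have [_ gy] := integrableP _ _ _ intg.
rewrite ge0_integralZr//; last exact: integral_ge0.
rewrite lte_mul_pinfty//; first exact: integral_ge0.
by rewrite ge0_fin_numE//; exact: integral_ge0.
Qed.

End integrable_mul_prod.

(** * An integrable product weight, and integrals of derivatives *)

Section weight.
Context {R : realType}.
Local Notation mu := (@lebesgue_measure R).
Local Notation TR := (measurableTypeR R).

Lemma integrable_oneDsqrV : mu.-integrable setT (EFin \o (fun s : R => (oneDsqr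
  s)^-1)).
Proof.
have w0 (s : R) : 0 <= (oneDsqr s)^-1 by rewrite invr_ge0 ltW ?oneDsqr_gt0.
apply/integrableP; split.
  apply/measurable_EFinP; apply: continuous_measurable_fun.
  exact: continuous_oneDsqrV.
under eq_integral do rewrite /= ger0_norm//.
rewrite ge0_symfun_integralT; last 3 first.
- exact: w0.
- exact: continuous_oneDsqrV.
- by move=> s; rewrite /oneDsqr/= sqrrN.
by rewrite -set_itvcy integral0y_oneDsqr ltry.
Qed.

(** A majorant in product form: Tonelli reduces its integrability to the arctangent integral, and it
    also dominates along every line parallel to an axis. *)
Definition weight3 (x : R * R * R) : R :=
  (oneDsqr x.1.1)^-1 * (oneDsqr x.1.2)^-1 * (oneDsqr x.2)^-1.

Lemma integrable_weight3 : lebesgue3.-integrable setT (EFin \o weight3).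
Proof.
apply: (integrable_mul_prod lebesgue2 mu
  (fun z : R * R => (oneDsqr z.1)^-1 * (oneDsqr z.2)^-1)
  (fun s => (oneDsqr s)^-1)) integrable_oneDsqrV.
exact: (integrable_mul_prod mu mu (fun s => (oneDsqr s)^-1)
  (fun s => (oneDsqr s)^-1)) integrable_oneDsqrV integrable_oneDsqrV.
Qed.

Lemma integrable_weighted (f : R * R * R -> R) (C : R) : continuous f ->
  (forall x, `|f x| <= C * weight3 x) ->
  lebesgue3.-integrable setT (EFin \o f).
Proof.
move=> cf fC; have intC := integrableZl measurableT C integrable_weight3.
apply: le_integrable intC => //.
- by apply/measurable_EFinP; exact: continuous_measurable_fun3.
- by move=> x _ /=; rewrite lee_fin (le_trans (fC x))// ler_norm.
Qed.

(** The fundamental theorem of calculus on growing intervals: the boundary terms vanish by the decay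
    of [g], and the integrals converge by domination of [dg]. *)
Lemma integral_derive0 (g dg : R -> R) (C : R) :
  (forall s : R, is_derive s 1 g (dg s)) -> continuous dg ->
  (forall s, `|g s| <= C / oneDsqr s) -> (forall s, `|dg s| <= C / oneDsqr s) ->
  (\int[mu]_s (dg s)%:E = 0)%E.
Proof.
move=> g' cdg gC dgC.
have dgC' s : `|dg s| <= `|C| * (oneDsqr s)^-1.
  by rewrite (le_trans (dgC s))// ler_wpM2r ?invr_ge0 ?(ltW (oneDsqr_gt0 _))//
    ler_norm.
have intw : mu.-integrable setT (fun s => (`|C| * (oneDsqr s)^-1)%:E).
  exact: (integrableZl measurableT `|C| integrable_oneDsqrV).
pose I (n : nat) : set R := [set` `[- n.+1%:R, n.+1%:R : R]].
have intI n : (\int[mu]_(s in I n) (dg s)%:E = (g n.+1%:R - g (- n.+1%:R))%:E)%E.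
  have cg (s : R) : {for s, continuous g}.
    by apply/differentiable_continuous/derivable1_diffP; have [] := g' s.
  rewrite (continuous_FTC2 (F := g)) ?EFinB//.
  - by have : 0 < n.+1%:R :> R by []; lra.
  - exact: continuous_subspaceT.
  - split; first by move=> s _; have [] := g' s.
    + exact/cvg_at_right_filter/cg.
    + exact/cvg_at_left_filter/cg.
  - by move=> s _; rewrite derive1E; have [] := g' s.
have cvI : (\int[mu]_(s in I n) (dg s)%:E @[n --> \oo] --> \int[mu]_s (dg
  s)%:E)%E.
  under eq_fun do rewrite integral_mkcond.
  pose f_ n : R -> \bar R := (EFin \o dg) \_ (I n).
  have [] // := @dominated_convergence _ _ _ mu setT measurableT f_
    (EFin \o dg) (fun s => (`|C| / oneDsqr s)%:E).
  - move=> n; apply/(measurable_restrictT (EFin \o dg)).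
      exact: measurable_itv.
    apply: measurable_funTS.
    by apply/measurable_EFinP; exact: continuous_measurable_fun.
  - by apply/measurable_EFinP; exact: continuous_measurable_fun.
  - apply/aeW => s _; apply: cvg_near_cst; near=> n.
    rewrite /f_ patchE mem_set// /I/= in_itv/= -ler_norml.
    have : `|s| <= n%:R by near: n; exact: nbhs_infty_ger.
    by move=> /le_trans; apply; rewrite ler_nat.
  - apply/aeW => s n _; rewrite /f_ patchE; case: ifP => _.
      by rewrite lee_fin.
    by rewrite abse0 lee_fin (le_trans _ (dgC' s)).
have cv0 : (g n.+1%:R - g (- n.+1%:R))%:E @[n --> \oo] --> 0%E.
  apply: cvg_EFin; first exact: nearW.
  apply/cvgr0Pnorm_le => e e0; near=> n.
  have h (s : R) : s ^+ 2 = n.+1%:R ^+ 2 -> `|g s| <= e / 2.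
    move=> sn; rewrite (le_trans (gC s))// ler_pdivrMr ?oneDsqr_gt0// /oneDsqr sn.
    have Ce : `|C| * 2 / e <= n%:R by near: n; exact: nbhs_infty_ger.
    move: Ce; rewrite ler_pdivrMr// -[n.+1%:R]natr1 => Ce.
    have := ler_norm C; have n0 : 0 <= n%:R :> R by [].
    have : 0 <= e * (n%:R ^+ 2 + n%:R + 2).
      by rewrite mulr_ge0 ?(ltW e0)// !addr_ge0 ?exprn_ge0.
    lra.
  rewrite (le_trans (ler_normB _ _))// (splitr e) lerD// h// sqrrN//.
move: cvI; under eq_fun do rewrite intI.
by move=> /(cvg_unique _ cv0) ->.
Unshelve. all: end_near.
Qed.
End weight.

Section integral_partial.
Context {R : realType}.
Local Notation mu := (@lebesgue_measure R).
Local Notation TR := (measurableTypeR R).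
Variables (g dg : R * R * R -> R) (C : R).
Hypotheses (cdg : continuous dg) (gC : forall x, `|g x| <= C * weight3 x)
  (dgC : forall x, `|dg x| <= C * weight3 x).

Let oneDsqrV_ge0 (s : R) : 0 <= (oneDsqr s)^-1.
Proof. by rewrite invr_ge0 ltW ?oneDsqr_gt0. Qed.

Let weight_bound (x : R * R * R) (s : R) (y : R) :
  s = x.1.1 \/ s = x.1.2 \/ s = x.2 ->
  `|y| <= C * weight3 x -> `|y| <= `|C| / oneDsqr s.
Proof.
move=> sx /le_trans; apply; rewrite /weight3.
have prod_le (a b c : R) : 0 <= a <= 1 -> 0 <= b <= 1 -> 0 <= c <= 1 ->
    C * (a * b * c) <= `|C| * a /\ C * (a * b * c) <= `|C| * b /\
    C * (a * b * c) <= `|C| * c.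
  move=> /andP[a0 a1] /andP[b0 b1] /andP[c0 c1].
  suff h (d : R) : a * b * c <= d -> C * (a * b * c) <= `|C| * d.
    have ab1 : a * b <= 1 by rewrite mulr_ile1.
    split; [|split]; apply: h; last by rewrite ler_piMl.
    - by rewrite -mulrA ler_piMr// mulr_ile1.
    - by rewrite mulrAC ler_piMl// mulr_ile1.
  move=> abcd; apply: (@le_trans _ _ (`|C| * (a * b * c))).
    by rewrite ler_wpM2r ?ler_norm// !mulr_ge0.
  by rewrite ler_wpM2l.
have w01 (r : R) : 0 <= (oneDsqr r)^-1 <= 1.
  by rewrite oneDsqrV_ge0; exact: oneDsqrV_le1.
have [h1 [h2 h3]] := prod_le _ _ _ (w01 x.1.1) (w01 x.1.2) (w01 x.2).
by case: sx => [->|[->|->]].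
Qed.

Let int_dg : lebesgue3.-integrable setT (EFin \o dg).
Proof. exact: integrable_weighted dgC. Qed.

(** Fubini's theorem on R^3 gives integrability of almost every slice only; the product form of the
    majorant gives it for every slice. *)
Let int_dg2 (x3 : R) :
  lebesgue2.-integrable setT (fun z : R * R => (dg (z, x3))%:E).
Proof.
have := integrableZl measurableT `|C| (integrable_mul_prod mu mu _ _
  (@integrable_oneDsqrV R) (@integrable_oneDsqrV R)).
apply: le_integrable => //.
- have /measurableT_comp := measurable_int _ int_dg.
  apply; exact: pair2_measurable.
- move=> z _ /=; rewrite lee_fin (le_trans (dgC _))// ger0_norm ?mulr_ge0//.
  rewrite /weight3/= mulrA (le_trans (ler_norm _))// normrM.
  rewrite (ger0_norm (oneDsqrV_ge0 _)) normrM (ger0_norm (mulr_ge0 _ _))//.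
  by rewrite ler_piMr ?mulr_ge0//; exact: oneDsqrV_le1.
Qed.

(** Fubini's theorem with the differentiated variable innermost: that inner integral vanishes for
    all values of the other two. The next two lemmas split the R^2 factor once more. *)
Lemma integral_partial3 :
  (forall x1 x2 s, is_derive (s : R) 1 (fun s => g (x1, x2, s)) (dg (x1, x2,
    s))) ->
  (\int[lebesgue3]_x (dg x)%:E = 0)%E.
Proof.
move=> g'; rewrite -(integral12_prod_meas1 (m1 := lebesgue2) (m2 := mu) int_dg).
rewrite /fubini_F integral0_eq// => -[x1 x2] _.
apply: (integral_derive0 (fun s => g (x1, x2, s)) _ `|C|) => // [|s|s].
- move=> s; apply: (@continuous_comp _ _ _ (fun s => (x1, x2, s)) dg);
  last exact: cdg.
  exact: (cvg_pair (cvg_cst _) cvg_id).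
- by apply: (weight_bound _ _ _ _ (gC _)); right; right.
- by apply: (weight_bound _ _ _ _ (dgC _)); right; right.
Qed.

Lemma integral_partial2 :
  (forall x1 x3 s, is_derive (s : R) 1 (fun s => g (x1, s, x3)) (dg (x1, s,
    x3))) ->
  (\int[lebesgue3]_x (dg x)%:E = 0)%E.
Proof.
move=> g'; rewrite -(integral21_prod_meas1 (m1 := lebesgue2) (m2 := mu) int_dg).
rewrite /fubini_G integral0_eq// => x3 _.
rewrite -(integral12_prod_meas1 (m1 := mu) (m2 := mu) (int_dg2 x3)).
rewrite /fubini_F integral0_eq// => x1 _.
apply: (integral_derive0 (fun s => g (x1, s, x3)) _ `|C|) => // [|s|s].
- move=> s; apply: (@continuous_comp _ _ _ (fun s => (x1, s, x3)) dg);
  last exact: cdg.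
  exact: (cvg_pair (cvg_pair (cvg_cst _) cvg_id) (cvg_cst _)).
- by apply: (weight_bound _ _ _ _ (gC _)); right; left.
- by apply: (weight_bound _ _ _ _ (dgC _)); right; left.
Qed.

Lemma integral_partial1 :
  (forall x2 x3 s, is_derive (s : R) 1 (fun s => g (s, x2, x3)) (dg (s, x2,
    x3))) ->
  (\int[lebesgue3]_x (dg x)%:E = 0)%E.
Proof.
move=> g'; rewrite -(integral21_prod_meas1 (m1 := lebesgue2) (m2 := mu) int_dg).
rewrite /fubini_G integral0_eq// => x3 _.
rewrite -(integral21_prod_meas1 (m1 := mu) (m2 := mu) (int_dg2 x3)).
rewrite /fubini_G integral0_eq// => x2 _.
apply: (integral_derive0 (fun s => g (s, x2, x3)) _ `|C|) => // [|s|s].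
- move=> s; apply: (@continuous_comp _ _ _ (fun s => (s, x2, x3)) dg);
  last exact: cdg.
  exact: (cvg_pair (cvg_pair cvg_id (cvg_cst _)) (cvg_cst _)).
- by apply: (weight_bound _ _ _ _ (gC _)); left.
- by apply: (weight_bound _ _ _ _ (dgC _)); left.
Qed.

End integral_partial.

(** * Mixed partial derivatives and the chain rule *)

Section mixed_derivatives.
Context {R : realType} {V : normedModType R}.
Implicit Types (f : V -> R) (v w z : V).

Lemma is_derive_line f z v (a : R) : derivable f (z + a *: v) v ->
  is_derive a 1 (fun t : R => f (z + t *: v)) ('D_v f (z + a *: v)).
Proof.
move=> df.
have E : (fun h : R => h^-1 *: (((fun t : R => f (z + t *: v)) \o shift a) (h *:
  1) - f (z + a *: v)))
   = (fun h : R => h^-1 *: ((f \o shift (z + a *: v)) (h *: v) - f (z + a *: v))).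
  apply/funext => h /=; congr (_ *: (f _ - _)).
  by rewrite [h *: 1]mulr1 scalerDl addrCA.
by split; [rewrite /derivable E|rewrite /derive E].
Qed.

Let second_diff f z v w (s : R) :=
  f (z + s *: v + s *: w) - f (z + s *: v) - f (z + s *: w) + f z.

(** The mean value theorem twice: along [v] for the increment of [f] in the direction [s *: w], then
    along [w] for ['D_v f]. *)
Lemma second_diff_MVT f z v w (s : R) : 0 < s ->
  (forall y, derivable f y v) -> (forall y, derivable ('D_v f) y w) ->
  exists a b : R, [/\ 0 < a < s, 0 < b < s &
    second_diff f z v w s = s ^+ 2 * 'D_w ('D_v f) (z + a *: v + b *: w)].
Proof.
move=> s0 dv dwv.
have MVT0 (p dp : R -> R) : (forall t : R, is_derive t 1 p (dp t)) ->
    exists2 c : R, 0 < c < s & p s - p 0 = s * dp c.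
  move=> p'; have cp : {within `[0, s], continuous p}.
    apply: continuous_subspaceT => t.
    by apply/differentiable_continuous/derivable1_diffP; have [] := p' t.
  have [c] := MVT s0 (fun t _ => p' t) cp.
  by rewrite in_itv/= => c01; rewrite subr0 mulrC; exists c.
have [a a0s pa] := MVT0 (fun t => f (z + s *: w + t *: v) - f (z + t *: v))
  (fun t => 'D_v f (z + s *: w + t *: v) - 'D_v f (z + t *: v))
  (fun t => is_deriveB (is_derive_line _ _ _ _ (dv _)) (is_derive_line _ _ _ _
    (dv _))).
have [b b0s qb] := MVT0 (fun t => 'D_v f (z + a *: v + t *: w)) _
  (fun t => is_derive_line _ _ _ _ (dwv _)).
exists a, b; split => //.
move: pa qb; rewrite !scale0r !addr0 addrAC => pa qb.
rewrite expr2 -mulrA -qb -(addrAC z (s *: w)) -pa /second_diff.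
rewrite (addrAC z (s *: v)); ring.
Qed.

Lemma second_diffC f z v w s : second_diff f z v w s = second_diff f z w v s.
Proof. by rewrite /second_diff (addrAC z (s *: v)); ring. Qed.

(** The second difference is symmetric in [v] and [w], so each mixed derivative takes, somewhere
    near [z], the same value; continuity at [z] transfers the equality to [z]. *)
Lemma derive_comm f v w z :
  (forall y, derivable f y v) -> (forall y, derivable f y w) ->
  (forall y, derivable ('D_v f) y w) -> (forall y, derivable ('D_w f) y v) ->
  {for z, continuous ('D_w ('D_v f))} -> {for z, continuous ('D_v ('D_w f))} ->
  'D_w ('D_v f) z = 'D_v ('D_w f) z.
Proof.
move=> dv dw dwv dvw cwv cvw; apply/eqP; rewrite -subr_eq0 -normr_le0.
apply/ler_addgt0Pl => e e0; rewrite addr0.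
have tri (p q r : R) : `|p - r| <= e / 2 -> `|q - r| <= e / 2 -> `|p - q| <= e.
  rewrite !ler_norml; lra.
have e20 : 0 < e / 2 by lra.
move/cvgrPdist_le : cwv => /(_ _ e20)/nbhs_ballP[d1 /= d10 h1].
move/cvgrPdist_le : cvw => /(_ _ e20)/nbhs_ballP[d2 /= d20 h2].
have mod0 : 0 < `|v| + `|w| + 1 by rewrite ltr_wpDl// addr_ge0.
(* Small enough for all intermediate points to lie in both balls; the added 1 covers [v = w = 0]. *)
pose s := Num.min d1 d2 / (`|v| + `|w| + 1).
have s0 : 0 < s by rewrite divr_gt0// lt_min d10.
have near_z (a b : R) (x y : V) : `|x| + `|y| =
  `|v| + `|w| -> 0 < a < s -> 0 < b < s ->
    `|z - (z + a *: x + b *: y)| < Num.min d1 d2.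
  move=> xy /andP[a0 as_] /andP[b0 bs].
  rewrite -addrA opprD addNKr normrN (le_lt_trans (ler_normD _ _))//.
  rewrite !normrZ !gtr0_norm// (@le_lt_trans _ _ (s * (`|v| + `|w|)))//.
    by rewrite -xy mulrDr lerD// ler_wpM2r// ltW.
  by rewrite /s mulrAC ltr_pdivrMr// ltr_pM2l ?lt_min ?d10//; lra.
have [a [b [ha hb E1]]] := second_diff_MVT f z v w s s0 dv dwv.
have [a' [b' [ha' hb' E2]]] := second_diff_MVT f z w v s s0 dw dvw.
have E : 'D_w ('D_v f) (z + a *: v + b *: w) =
  'D_v ('D_w f) (z + a' *: w + b' *: v).
  apply: (@mulfI _ (s ^+ 2)); first by rewrite expf_neq0// gt_eqF.
  exact: (etrans (esym E1) (etrans (second_diffC f z v w s) E2)).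
have near1 := near_z a b v w erefl ha hb.
have near2 := near_z a' b' w v (addrC _ _) ha' hb'.
move: near1 near2; rewrite !lt_min => /andP[near1 _] /andP[_ near2].
have {}h1 : `|'D_w ('D_v f) z - 'D_w ('D_v f) (z + a *: v + b *: w)| <= e / 2.
  by apply: h1; rewrite -ball_normE.
have {}h2 : `|'D_v ('D_w f) z - 'D_v ('D_w f) (z + a' *: w + b' *: v)| <= e / 2.
  by apply: h2; rewrite -ball_normE.
rewrite E in h1.
exact: tri h1 h2.
Qed.
End mixed_derivatives.

Section chain_rule.
Context {R : realType}.
Implicit Types (f u : spacetime R -> R).

Lemma differentiable_is_derive f (g1 g2 g3 g4 : R -> R) (d1 d2 d3 d4 s : R) :
  is_derive s 1 g1 d1 -> is_derive s 1 g2 d2 ->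
  is_derive s 1 g3 d3 -> is_derive s 1 g4 d4 ->
  let z := (g1 s, g2 s, g3 s, g4 s) in differentiable f z ->
  is_derive s 1 (fun t => f (g1 t, g2 t, g3 t, g4 t))
    (d1 * partial dir_x1 f z + d2 * partial dir_x2 f z
     + d3 * partial dir_x3 f z + d4 * partial dir_t f z).
Proof.
move=> g1' g2' g3' g4' z df.
pose g (t : R) : spacetime R := (g1 t, g2 t, g3 t, g4 t).
have dif (h : R -> R) (d : R) : is_derive s 1 h d ->
    differentiable h s /\ 'd h s 1 = d.
  move=> h'; have dh : differentiable h s by apply/derivable1_diffP;
    have [] := h'.
  by split=> //; rewrite -deriveE//; exact: derive_val.
have [dg1 e1] := dif _ _ g1'; have [dg2 e2] := dif _ _ g2'.
have [dg3 e3] := dif _ _ g3'; have [dg4 e4] := dif _ _ g4'.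
have dg12 := differentiable_pair dg1 dg2.
have dg123 := differentiable_pair dg12 dg3.
have dg : differentiable g s := differentiable_pair dg123 dg4.
have dfg : differentiable (f \o g) s by exact: differentiable_comp.
apply: DeriveDef; first exact: diff_derivable.
rewrite deriveE// diff_comp//=.
rewrite diff_pair//= diff_pair//= diff_pair//= e1 e2 e3 e4.
have -> : (d1, d2, d3, d4) = d1 *: dirvec R dir_x1 + d2 *: dirvec R dir_x2
    + d3 *: dirvec R dir_x3 + d4 *: dirvec R dir_t.
  by congr (_, _, _, _); rewrite /= !scaler0 ?addr0 ?add0r [_%:A]mulr1.
by rewrite !linearD !linearZ/= /partial !deriveE.
Qed.

Lemma partial_comm u (a b : direction) z : smooth u ->
  partial a (partial b u) z = partial b (partial a u) z.
Proof.
move=> su; have dif d := su d.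
have dv (d : direction) (ds : seq direction) y :
    derivable (partials ds u) y (dirvec R d).
  exact: diff_derivable.
apply: derive_comm => [y|y|y|y||].
- exact: (dv b [::]).
- exact: (dv a [::]).
- exact: (dv a [:: b]).
- exact: (dv b [:: a]).
- exact/differentiable_continuous/(su [:: a; b]).
- exact/differentiable_continuous/(su [:: b; a]).
Qed.

End chain_rule.

(** * Classes of decaying functions *)

Section decay_classes.
Context {R : realType}.
Implicit Types (f g : R -> R3 R -> R).

(* The parameter [m] is the slope of a surface [t = m phi(x1)]; the bounds are
   uniform in [|m| <= 1]. *)
Definition rapid f :=
  (forall m, continuous (f m)) /\
  forall N : nat, exists C : R, forall m x, `|m| <= 1 ->
    `|f m x| * japanese x ^+ N <= C.

Definition slow f :=
  (forall m, continuous (f m)) /\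
  exists (N : nat) (C : R), forall m x, `|m| <= 1 ->
    `|f m x| <= C * japanese x ^+ N.

Lemma sqr_japanese (x : R3 R) :
  japanese x ^+ 2 = 1 + (coord1 x ^+ 2 + coord2 x ^+ 2 + coord3 x ^+ 2).
Proof. by rewrite sqr_sqrtr// addr_ge0// !addr_ge0 ?sqr_ge0. Qed.

Lemma japanese_ge1 (x : R3 R) : 1 <= japanese x.
Proof.
by rewrite -[leLHS]sqrtr1 ler_wsqrtr// lerDl !addr_ge0 ?sqr_ge0.
Qed.

Lemma japanese_gt0 (x : R3 R) : 0 < japanese x.
Proof. exact: lt_le_trans ltr01 (japanese_ge1 x). Qed.

Let jX_gt0 N (x : R3 R) : 0 < japanese x ^+ N.
Proof. by rewrite exprn_gt0// japanese_gt0. Qed.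

Let jX_ge1 N (x : R3 R) : 1 <= japanese x ^+ N.
Proof. by rewrite exprn_ege1// japanese_ge1. Qed.

Lemma rapidM f g : rapid f -> slow g -> rapid (fun m x => f m x * g m x).
Proof.
move=> [cf rf] [cg [N [C sg]]]; split=> [m x|M];
  first exact: cvgM (cf _ _) (cg _ _).
have [C' fC'] := rf (N + M)%N.
exists (C' * C) => m x m1; rewrite normrM.
have jN := jX_gt0 N x; have jM := jX_gt0 M x.
have := ler_wpM2r (ltW jM) (ler_wpM2l (normr_ge0 (f m x)) (sg m x m1)).
move=> /le_trans; apply.
have C0 : 0 <= C.
  rewrite -(pmulr_lge0 C jN); exact: le_trans (normr_ge0 _) (sg m x m1).
have := ler_wpM2r C0 (fC' m x m1); rewrite exprD; lra.
Qed.

Lemma slowM f g : slow f -> slow g -> slow (fun m x => f m x * g m x).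
Proof.
move=> [cf [M [D sf]]] [cg [N [C sg]]].
split=> [m x|]; first exact: cvgM (cf _ _) (cg _ _).
exists (M + N)%N, (D * C) => m x m1; rewrite normrM exprD mulrACA.
exact: ler_pM (sf _ _ m1) (sg _ _ m1).
Qed.

Lemma rapidD f g : rapid f -> rapid g -> rapid (fun m x => f m x + g m x).
Proof.
move=> [cf rf] [cg rg]; split=> [m x|N]; first exact: cvgD (cf _ _) (cg _ _).
have [C fC] := rf N; have [C' gC'] := rg N.
exists (C + C') => m x m1; apply: (le_trans _ (lerD (fC m x m1) (gC' m x m1))).
by rewrite -mulrDl ler_pM2r// ler_normD.
Qed.

Lemma slowD f g : slow f -> slow g -> slow (fun m x => f m x + g m x).
Proof.
move=> [cf [M [D sf]]] [cg [N [C sg]]].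
split=> [m x|]; first exact: cvgD (cf _ _) (cg _ _).
exists (M + N)%N, (`|D| + `|C|) => m x m1; rewrite (le_trans (ler_normD _ _))//.
have hM := jX_ge1 M x; have hN := jX_ge1 N x.
rewrite mulrDl lerD//.
  rewrite (le_trans (sf _ _ m1))// (@le_trans _ _ (`|D| * japanese x ^+ M))//.
    by rewrite ler_pM2r// ler_norm.
  by rewrite ler_wpM2l// exprD ler_peMr// ltW.
rewrite (le_trans (sg _ _ m1))// (@le_trans _ _ (`|C| * japanese x ^+ N))//.
  by rewrite ler_pM2r// ler_norm.
by rewrite ler_wpM2l// exprD ler_peMl// ltW.
Qed.

Lemma slow_cst (c : R) : slow (fun _ _ => c).
Proof.
split=> [m x|]; first exact: cvg_cst.
by exists 0%N, `|c| => m x _; rewrite expr0 mulr1.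
Qed.

Lemma slow_id : slow (fun m _ => m).
Proof.
split=> [m x|]; first exact: cvg_cst.
by exists 0%N, 1 => m x m1; rewrite expr0 mulr1.
Qed.

Lemma rapid_slow f : rapid f -> slow f.
Proof.
move=> [cf rf]; split=> //; have [C fC] := rf 0%N.
by exists 0%N, C => m x m1;
  rewrite expr0 mulr1 -(mulr1 `|_|) -(expr0 (japanese x)) fC.
Qed.

Lemma slow_bounded f (C : R) : (forall m, continuous (f m)) ->
  (forall m x, `|m| <= 1 -> `|f m x| <= C) -> slow f.
Proof. by move=> cf fC; split=> //; exists 0%N, C => m x m1;
  rewrite expr0 mulr1 fC. Qed.

Lemma rapidN f : rapid f -> rapid (fun m x => - f m x).
Proof.
move=> [cf rf]; split=> [m x|N]; first exact: cvgN (cf _ _).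
by have [C fC] := rf N; exists C => m x m1; rewrite normrN fC.
Qed.

Lemma rapidMl f g : slow f -> rapid g -> rapid (fun m x => f m x * g m x).
Proof.
move=> sf rg; have := rapidM _ _ rg sf.
by congr rapid; apply/funext => m; apply/funext => x; rewrite mulrC.
Qed.

Lemma slowX f n : slow f -> slow (fun m x => f m x ^+ n).
Proof.
move=> sf; elim: n => [|n ih]; first exact: slow_cst.
have := slowM _ _ sf ih.
by congr slow; apply/funext => m; apply/funext => x; rewrite exprS.
Qed.

Lemma continuous_coord1 : continuous (@coord1 R).
Proof. by move=> x; apply: continuous_comp; [exact: cvg_fst|exact: cvg_fst]. Qed.

Lemma continuous_coord2 : continuous (@coord2 R).
Proof. by move=> x; apply: continuous_comp; [exact: cvg_fst|exact: cvg_snd]. Qed.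

Lemma continuous_coord3 : continuous (@coord3 R).
Proof. by move=> x; exact: cvg_snd. Qed.

Lemma coord_le_japanese (x : R3 R) : [/\ `|coord1 x| <= japanese x,
  `|coord2 x| <= japanese x & `|coord3 x| <= japanese x].
Proof.
have h (s : R) : s ^+ 2 <= japanese x ^+ 2 -> `|s| <= japanese x.
  by rewrite -(ler_sqr (normr_ge0 _)) ?real_normK ?num_real// nnegrE ltW
    ?japanese_gt0.
have := sqr_ge0 (coord1 x); have := sqr_ge0 (coord2 x);
  have := sqr_ge0 (coord3 x).
by split; apply: h; rewrite sqr_japanese; lra.
Qed.

Lemma slow_coord1 : slow (fun _ x => coord1 x).
Proof.
split=> [m|]; first exact: continuous_coord1.
by exists 1%N, 1 => m x _; rewrite mul1r expr1; have [] := coord_le_japanese x.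
Qed.

Lemma slow_coord2 : slow (fun _ x => coord2 x).
Proof.
split=> [m|]; first exact: continuous_coord2.
by exists 1%N, 1 => m x _; rewrite mul1r expr1; have [] := coord_le_japanese x.
Qed.

Lemma slow_coord3 : slow (fun _ x => coord3 x).
Proof.
split=> [m|]; first exact: continuous_coord3.
by exists 1%N, 1 => m x _; rewrite mul1r expr1; have [] := coord_le_japanese x.
Qed.

Lemma slow_inv_sqr_japanese : slow (fun _ x => (japanese x ^+ 2)^-1).
Proof.
apply: (slow_bounded _ 1) => [m x|m x _].
  apply: cvgV; first by rewrite gt_eqF.
  have -> : (fun x : R3 R => japanese x ^+ 2) =
      (fun x => 1 + (coord1 x ^+ 2 + coord2 x ^+ 2 + coord3 x ^+ 2)).
    by apply/funext => y; rewrite sqr_japanese.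
  rewrite sqr_japanese; apply: cvgD; first exact: cvg_cst.
  apply: cvgD; [apply: cvgD|].
  - by apply: cvgM; exact: continuous_coord1.
  - by apply: cvgM; exact: continuous_coord2.
  - by apply: cvgM; exact: continuous_coord3.
by rewrite ger0_norm ?invr_ge0 ?(ltW (jX_gt0 _ _))// invf_le1.
Qed.

(** The exponent 6 is what dominates the product weight: each of the three factors [1 + xi^2] is at
    most the square of [japanese x]. *)
Lemma rapid_weight f : rapid f -> exists C : R, forall m x, `|m| <= 1 ->
  `|f m x| <= C * weight3 x.
Proof.
move=> [_ /(_ 6%N)[C fC]]; exists C => m x m1.
have jx : oneDsqr x.1.1 * oneDsqr x.1.2 * oneDsqr x.2 <= japanese x ^+ 6.
  rewrite -[6%N]/(2 * 3)%N exprM sqr_japanese /coord1 /coord2 /coord3.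
  have := sqr_ge0 x.1.1; have := sqr_ge0 x.1.2; have := sqr_ge0 x.2.
  rewrite /oneDsqr; set a := _ ^+ 2; set b := x.1.2 ^+ 2;
    set c := x.1.1 ^+ 2 => a0 b0 c0.
  rewrite !exprS expr0 mulr1 mulrA.
  by apply: ler_pM; [|lra|apply: ler_pM|]; rewrite ?mulr_ge0//; lra.
have w : 0 < oneDsqr x.1.1 * oneDsqr x.1.2 * oneDsqr x.2.
  by rewrite !mulr_gt0 ?oneDsqr_gt0.
have -> : weight3 x = (oneDsqr x.1.1 * oneDsqr x.1.2 * oneDsqr x.2)^-1.
  by rewrite /weight3 !invfM.
rewrite ler_pdivlMr//; apply: (le_trans _ (fC m x m1)).
by rewrite ler_wpM2l.
Qed.

Lemma rapid_integrable f m : rapid f -> `|m| <= 1 ->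
  lebesgue3.-integrable setT (EFin \o f m).
Proof.
move=> rf m1; have [C fC] := rapid_weight _ rf.
by apply: (integrable_weighted _ C) => [|x]; [case: rf|exact: fC].
Qed.

End decay_classes.

Section derive1_rules.
Context {R : realType}.
Implicit Types (f g : R -> R).

Lemma is_derive1_eq f (x d d' : R) : is_derive x 1 f d -> d =
  d' -> is_derive x 1 f d'.
Proof. by move=> h <-. Qed.

Lemma is_derive1M f g (x df dg : R) : is_derive x 1 f df -> is_derive x 1 g dg ->
  is_derive x 1 (fun t => f t * g t) (df * g x + f x * dg).
Proof.
move=> hf hg; apply: (is_derive1_eq _ _ _ _ (is_deriveM hf hg)).
by rewrite addrC mulrC.
Qed.

Lemma is_derive1D f g (x df dg : R) : is_derive x 1 f df -> is_derive x 1 g dg ->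
  is_derive x 1 (fun t => f t + g t) (df + dg).
Proof. by move=> hf hg; exact: (is_deriveD hf hg). Qed.

Lemma is_derive1X f n (x df : R) : is_derive x 1 f df ->
  is_derive x 1 (fun t => f t ^+ n) (n%:R * f x ^+ n.-1 * df).
Proof.
move=> hf; have -> : (fun t => f t ^+ n) = f ^+ n.
  by apply/funext => t; rewrite exprfctE.
exact: (is_deriveX n hf).
Qed.

Lemma is_derive1_sqr f (x df : R) : is_derive x 1 f df ->
  is_derive x 1 (fun t => f t ^+ 2) (2 * f x * df).
Proof. by move=> hf; have := is_derive1X f 2 x df hf; rewrite expr1. Qed.

Lemma is_derive1V f (x df : R) : f x != 0 -> is_derive x 1 f df ->
  is_derive x 1 (fun t => (f t)^-1) (- df / f x ^+ 2).
Proof.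
move=> f0 hf; apply: (is_derive1_eq _ _ _ _ (is_deriveV f0 hf)).
by rewrite -[_ *: _]/(_ * _) mulrC mulNr mulrN.
Qed.

End derive1_rules.

(** * Traces of the derivatives of u on the surfaces t = m phi(x1) *)

Section fields.
Context {R : realType}.
Variables (u : spacetime R -> R) (su : smooth u) (du : fast_decay u).
Variables (phi psi : R -> R) (B : R).
Hypotheses (phi' : forall s : R, is_derive s 1 phi (psi s))
  (phi_bound : forall s, `|phi s| <= B).

(** Indexed by the list of directions, so that differentiating a trace in any variable only prepends
    directions to the list. *)
Definition field (ds : seq direction) (m : R) (x : R3 R) : R :=
  partials ds u (x, m * phi (coord1 x)).

Lemma continuous_field ds m : continuous phi -> continuous (field ds m).
Proof.
move=> cphi x.
apply: (@continuous_comp _ _ _ (fun x => (x, m * phi (coord1 x))) (partials ds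
  u)).
  have cmphi : (fun y => m * phi (coord1 y)) @ x --> m * phi (coord1 x).
    apply: cvgM; first exact: cvg_cst.
    apply: (@continuous_comp _ _ _ (@coord1 R) phi); last exact: cphi.
    exact: continuous_coord1.
  exact: (cvg_pair cvg_id cmphi).
exact/differentiable_continuous/su.
Qed.

Lemma continuous_phi : continuous phi.
Proof.
by move=> s; apply/differentiable_continuous/derivable1_diffP; have [] := phi' s.
Qed.

(** A bounded [phi] confines all surfaces of slope at most 1 to the slab |t| <= B, on which
    [fast_decay] is uniform. *)
Lemma rapid_field ds : rapid (field ds).
Proof.
split=> [m|N]; first exact: (continuous_field ds m continuous_phi).
have [C uC] := du ds N B; exists C => m x m1.
rewrite -ler_pdivlMr ?exprn_gt0 ?japanese_gt0// uC// normrM.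
by rewrite (le_trans _ (phi_bound (coord1 x)))// ler_piMl.
Qed.

Lemma is_derive_field_m ds m x : is_derive (m : R) 1 (fun t => field ds t x)
  (phi (coord1 x) * field (dir_t :: ds) m x).
Proof.
case: x => -[x1 x2] x3.
have h4 : is_derive m 1 (fun t => t * phi x1) (phi x1).
  apply: (is_derive1_eq _ _ _ _ (is_derive1M _ _ _ _ _ (is_derive_id _ _)
    (is_derive_cst _ _ _))).
  by rewrite mul1r mulr0 addr0.
have alg (a b c d e : R) : 0 * a + 0 * b + 0 * c + d * e = d * e by ring.
apply: (is_derive1_eq _ _ _ _ (differentiable_is_derive (partials ds u)
  _ _ _ _ _ _ _ _ m (is_derive_cst x1 _ _) (is_derive_cst x2 _ _) (is_derive_cst
    x3 _ _) h4 (su _ _))).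
exact: alg.
Qed.

Lemma is_derive_field1 ds m x2 x3 (s : R) :
  is_derive s 1 (fun t => field ds m (t, x2, x3))
  (field (dir_x1 :: ds) m (s, x2, x3) + m * psi s * field (dir_t :: ds) m (s,
    x2, x3)).
Proof.
have h4 : is_derive s 1 (fun t => m * phi t) (m * psi s).
  apply: (is_derive1_eq _ _ _ _ (is_derive1M _ _ _ _ _ (is_derive_cst _ _ _)
    (phi' s))).
  by rewrite mul0r add0r.
have alg (a b c d e : R) : 1 * a + 0 * b + 0 * c + d * e = a + d * e by ring.
apply: (is_derive1_eq _ _ _ _ (differentiable_is_derive (partials ds u)
  _ _ _ _ _ _ _ _ s (is_derive_id _ _) (is_derive_cst x2 _ _) (is_derive_cst x3
    _ _) h4 (su _ _))).
exact: alg.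
Qed.

Lemma is_derive_field2 ds m x1 x3 (s : R) :
  is_derive s 1 (fun t => field ds m (x1, t, x3))
  (field (dir_x2 :: ds) m (x1, s, x3)).
Proof.
have h4 := is_derive_cst (m * phi x1) s 1.
have alg (a b c e : R) : 0 * a + 1 * b + 0 * c + 0 * e = b by ring.
apply: (is_derive1_eq _ _ _ _ (differentiable_is_derive (partials ds u)
  _ _ _ _ _ _ _ _ s (is_derive_cst x1 _ _) (is_derive_id _ _) (is_derive_cst x3
    _ _) h4 (su _ _))).
exact: alg.
Qed.

Lemma is_derive_field3 ds m x1 x2 (s : R) :
  is_derive s 1 (fun t => field ds m (x1, x2, t))
  (field (dir_x3 :: ds) m (x1, x2, s)).
Proof.
have h4 := is_derive_cst (m * phi x1) s 1.
have alg (a b c e : R) : 0 * a + 0 * b + 1 * c + 0 * e = c by ring.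
apply: (is_derive1_eq _ _ _ _ (differentiable_is_derive (partials ds u)
  _ _ _ _ _ _ _ _ s (is_derive_cst x1 _ _) (is_derive_cst x2 _ _) (is_derive_id
    _ _) h4 (su _ _))).
exact: alg.
Qed.

End fields.

(** * Pointwise inequalities *)

Section pointwise.
Context {R : realFieldType}.

(* The first summand on the right is twice the divergence of
   [X w^2 (x1, x2, x3) / J] when [w] has gradient [(a1 + s a4, a2, a3)]. *)
Lemma hardy_pointwise (k s x1 x2 x3 w a1 a2 a3 a4 : R) : 0 <= k -> `|s| <= 1 ->
  let J := 1 + (x1 ^+ 2 + x2 ^+ 2 + x3 ^+ 2) in
  let X := 1 + k * x1 ^+ 2 in
  let a := a1 ^+ 2 + a2 ^+ 2 + a3 ^+ 2 + a4 ^+ 2 in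
  (X * (w ^+ 2 / J) <= 2 * (2 * k * x1 ^+ 2 * w ^+ 2 / J
    + X * (2 * w * ((a1 + s * a4) * x1 + a2 * x2 + a3 * x3) / J
           + w ^+ 2 * (3 / J - 2 * (x1 ^+ 2 + x2 ^+ 2 + x3 ^+ 2) / J ^+ 2)))
    + 8 * (X * a) : Prop).
Proof.
move=> k0 s1 J X a.
have x10 := sqr_ge0 x1; have x20 := sqr_ge0 x2; have x30 := sqr_ge0 x3.
have J0 : 0 < J by rewrite /J; lra.
have X0 : 0 < X by rewrite ltr_wpDr// mulr_ge0.
set y := J^-1; have y0 : 0 < y by rewrite invr_gt0.
have yE : (x1 ^+ 2 + x2 ^+ 2 + x3 ^+ 2) * y = 1 - y.
  have -> : x1 ^+ 2 + x2 ^+ 2 + x3 ^+ 2 = J - 1 by rewrite /J; ring.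
  by rewrite mulrBl mulfV ?gt_eqF// mul1r.
have J2 : 2 * (x1 ^+ 2 + x2 ^+ 2 + x3 ^+ 2) / J ^+ 2 = 2 * (1 - y) * y.
  by rewrite -yE -exprVn -/y; ring.
rewrite J2 -/y.
have b1a : (a1 + s * a4) ^+ 2 <= 2 * a1 ^+ 2 + 2 * a4 ^+ 2.
  have s2 : s ^+ 2 <= 1 by rewrite -real_normK ?num_real// exprn_ile1.
  have := sqr_ge0 (a1 - s * a4); have := ler_wpM2r (sqr_ge0 a4) s2; lra.
(* Twice the divergence contains [2 w^2 y + 4 w^2 y^2] besides the cross terms. Absorbing these
   costs at most [w^2 y (1 - y)] and four times the squared tangential gradient, which is at most
   [2 a] by [b1a]: hence the 8. *)
have sq (t b : R) : - (w * y * t) ^+ 2 - 4 * b ^+ 2 <= 4 * (w * y * t * b).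
  by have := sqr_ge0 (w * y * t + 2 * b); lra.
have sum3 : (w * y * x1) ^+ 2 + (w * y * x2) ^+ 2 + (w * y * x3) ^+ 2 =
  w ^+ 2 * y * (1 - y).
  by rewrite -yE; ring.
have := sq x1 (a1 + s * a4); have := sq x2 a2; have := sq x3 a3.
have w0 : 0 <= w ^+ 2 * y ^+ 2 by rewrite mulr_ge0 ?sqr_ge0.
have kx : 0 <= k * x1 ^+ 2 * w ^+ 2 * y by rewrite mulr_ge0 ?(ltW y0)// mulr_ge0
  ?sqr_ge0// mulr_ge0.
move=> e3 e2 e1.
have br : w ^+ 2 * y <= 2 * (2 * w * ((a1 + s * a4) * x1 + a2 * x2 + a3 * x3) * y
           + w ^+ 2 * (3 * y - 2 * (1 - y) * y)) + 8 * a.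
  have := sqr_ge0 a2; have := sqr_ge0 a3; rewrite /a; lra.
have := ler_wpM2l (ltW X0) br; lra.
Qed.

(** The left side is what remains of the [m]-derivative of the flux once the divergences are removed
    and the equation is used: the potential term and the derivative of the weight. On the right, [c]
    multiplies the Hardy divergence and the last factor is the flux density, [p] and [s] standing
    for phi(x1) and its derivative. *)
Lemma flux_pointwise (k c b p s m x1 x2 x3 w a1 a2 a3 a4 V : R) :
  0 <= k -> 0 <= c -> b < 1 -> `|m| <= b -> `|s| <= 1 -> `|p| <= `|x1| ->
  let J := 1 + (x1 ^+ 2 + x2 ^+ 2 + x3 ^+ 2) in
  let X := 1 + k * x1 ^+ 2 in
  `|V| <= c / J ->
  `|- (X * p * a4 * (V * w)) - 2 * k * x1 * p * a4 * a1| <=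
  c * (2 * k * x1 ^+ 2 * w ^+ 2 / J
    + X * (2 * w * ((a1 + m * s * a4) * x1 + a2 * x2 + a3 * x3) / J
           + w ^+ 2 * (3 / J - 2 * (x1 ^+ 2 + x2 ^+ 2 + x3 ^+ 2) / J ^+ 2)))
  + (9 * c + 2) / (1 - b) * (X * ((a1 ^+ 2 + a2 ^+ 2 + a3 ^+ 2 + a4 ^+ 2) / 2
      + m * s * (a4 * a1))).
Proof.
move=> k0 c0 b1 mb s1 px J X Vc.
have x10 := sqr_ge0 x1; have x20 := sqr_ge0 x2; have x30 := sqr_ge0 x3.
have J0 : 0 < J by rewrite /J; lra.
have X0 : 0 < X by rewrite ltr_wpDr// mulr_ge0.
have ms : `|m * s| <= b by rewrite normrM -(mulr1 b) ler_pM.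
have ms1 : `|m * s| <= 1 by lra.
have := hardy_pointwise k (m * s) x1 x2 x3 w a1 a2 a3 a4 k0 ms1.
rewrite -/J -/X /=; set a := a1 ^+ 2 + _ + _ + _;
  set D := (2 * k * _ * _ / _ + _).
set Q := _ / 2 + _ => hardy.
have a10 := sqr_ge0 a1; have a20 := sqr_ge0 a2; have a30 := sqr_ge0 a3.
have a40 := sqr_ge0 a4.
have a14 : `|a4 * a1| <= a / 2.
  rewrite ler_norml /a; have := sqr_ge0 (a1 - a4); have := sqr_ge0 (a1 + a4); lra.
have Qa : (1 - b) * (a / 2) <= Q.
  have : `|m * s * (a4 * a1)| <= b * (a / 2) by rewrite normrM ler_pM.
  by rewrite ler_norml /Q; lra.
have aQ : X * a <= 2 / (1 - b) * (X * Q).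
  rewrite mulrAC ler_pdivlMr ?subr_gt0//.
  have := ler_wpM2l (ltW X0) Qa; lra.
have px2 : `|x1 * p| <= x1 ^+ 2.
  by rewrite normrM -(real_normK (num_real x1)) expr2 ler_wpM2l.
have t2 : `|2 * k * x1 * p * a4 * a1| <= X * a.
  have -> : 2 * k * x1 * p * a4 * a1 = 2 * k * ((x1 * p) * (a4 * a1)) by ring.
  rewrite normrM ger0_norm ?mulr_ge0//.
  have : `|x1 * p * (a4 * a1)| <= x1 ^+ 2 * (a / 2) by rewrite normrM ler_pM.
  move=> /(ler_wpM2l (mulr_ge0 (ler0n R 2) k0)); have : 0 <= a by rewrite /a; lra.
  by rewrite /X; lra.
(* The inverse square decay of V is exactly enough: the factor [p], of size |x1|, uses up one power
   of the decay, and the other one is left for Hardy's inequality. *)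
have t1 : `|p * a4 * (V * w)| <= c / 2 * (w ^+ 2 / J + a4 ^+ 2).
  have h1 : `|p * a4 * (V * w)| <= c * (`|a4| * (`|x1| * `|w| / J)).
    rewrite !normrM.
    have : `|p| * `|V| <= `|x1| * (c / J) by rewrite ler_pM.
    move=> /(ler_wpM2r (mulr_ge0 (normr_ge0 a4) (normr_ge0 w))); lra.
  have h2 : (`|x1| * `|w| / J) ^+ 2 <= w ^+ 2 / J.
    rewrite exprMn exprMn !real_normK ?num_real// expr2 exprVn.
    have -> : x1 ^+ 2 * w ^+ 2 / J ^+ 2 = w ^+ 2 / J * (x1 ^+ 2 / J).
      by field; rewrite gt_eqF.
    apply: ler_piMr; first by rewrite divr_ge0 ?sqr_ge0// ltW.
    rewrite ler_pdivrMr// mul1r /J; lra.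
  have := sqr_ge0 (`|a4| - `|x1| * `|w| / J).
  have h3 : `|a4| ^+ 2 = a4 ^+ 2 by rewrite real_normK ?num_real.
  move=> h4; apply: (le_trans h1).
  have : `|a4| * (`|x1| * `|w| / J) <= (w ^+ 2 / J + a4 ^+ 2) / 2.
    move: h2 h4; rewrite -h3; set r := _ / J; lra.
  by move=> /(ler_wpM2l c0); lra.
have {}t1 : `|X * p * a4 * (V * w)| <=
  c / 2 * (X * (w ^+ 2 / J)) + c / 2 * (X * a).
  have -> : X * p * a4 * (V * w) = X * (p * a4 * (V * w)) by ring.
  rewrite normrM (gtr0_norm X0).
  have a4a : a4 ^+ 2 <= a by rewrite /a; lra.
  have := ler_wpM2l (ltW X0) t1.
  have := ler_wpM2l (mulr_ge0 c0 (ltW X0)) a4a; lra.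
apply: (le_trans (ler_normB _ _)); rewrite normrN.
(* In units of [X * a] the cost is [4 c] from Hardy (half of 8), [c / 2] from the potential term and
   1 from the weight, in total [(9 c + 2) / 2]; [aQ] then converts [X * a] into flux. *)
have -> : (9 * c + 2) / (1 - b) * (X * Q) =
  (9 * c + 2) / 2 * (2 / (1 - b) * (X * Q)).
  by field; rewrite gt_eqF// subr_gt0.
have c2 : 0 <= (9 * c + 2) / 2 by lra.
have := ler_wpM2l c2 aQ.
have := ler_wpM2l c0 hardy; lra.
Qed.

End pointwise.

(** * The energy identity along truncated surfaces *)

Section more_classes.
Context {R : realType}.

Lemma rapidX2 (f : R -> R3 R -> R) : rapid f -> rapid (fun m x => f m x ^+ 2).
Proof. by move=> rf; exact: rapidM (rapid_slow _ rf). Qed.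

Lemma slow_invJ : slow (fun (_ : R) (x : R3 R) =>
  (1 + (coord1 x ^+ 2 + coord2 x ^+ 2 + coord3 x ^+ 2))^-1).
Proof.
have := @slow_inv_sqr_japanese R.
by congr slow; apply/funext => m; apply/funext => x; rewrite sqr_japanese.
Qed.

Lemma slow_invJ2 : slow (fun (_ : R) (x : R3 R) =>
  ((1 + (coord1 x ^+ 2 + coord2 x ^+ 2 + coord3 x ^+ 2)) ^+ 2)^-1).
Proof.
have := slowX _ 2 slow_invJ.
by congr slow; apply/funext => m; apply/funext => x; rewrite exprVn.
Qed.

Lemma slowN (f : R -> R3 R -> R) : slow f -> slow (fun m x => - f m x).
Proof.
move=> sf; have := slowM _ _ (slow_cst (-1)) sf.
by congr slow; apply/funext => m; apply/funext => x; rewrite mulN1r.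
Qed.

End more_classes.

Lemma addr_eq0_subr (R : ringType) (p q r : R) : p - q + r = 0 -> p = q - r.
Proof. by move=> /eqP; rewrite addr_eq0 subr_eq addrC => /eqP. Qed.

(** * Integrating divergences, and differentiating in the slope *)

Section rapid_integral0.
Context {R : realType}.
Variables (Y dY : R -> R3 R -> R).
Hypotheses (rY : rapid Y) (rdY : rapid dY).

Let weight_bounds (m : R) : `|m| <= 1 -> exists C : R,
  (forall x, `|Y m x| <= C * weight3 x) /\ (forall x, `|dY m x| <= C * weight3 x).
Proof.
move=> m1; have [C YC] := rapid_weight _ rY; have [D dYD] := rapid_weight _ rdY.
exists (Num.max C D); split=> x.
  rewrite (le_trans (YC m x m1))// ler_wpM2r ?le_max ?lexx//.
  by rewrite /weight3 !mulr_ge0// invr_ge0 ltW// oneDsqr_gt0.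
rewrite (le_trans (dYD m x m1))// ler_wpM2r ?le_max ?lexx ?orbT//.
by rewrite /weight3 !mulr_ge0// invr_ge0 ltW// oneDsqr_gt0.
Qed.

Lemma rapid_integral_partial1 :
  (forall m x2 x3 s, is_derive (s : R) 1 (fun s => Y m (s, x2, x3)) (dY m (s,
    x2, x3))) ->
  forall m, `|m| <= 1 -> \int[lebesgue3]_x dY m x = 0.
Proof.
move=> Y' m m1; have [C [YC dYC]] := weight_bounds m m1.
by rewrite /Rintegral (integral_partial1 (Y m) (dY m) C (rdY.1 m)).
Qed.

Lemma rapid_integral_partial2 :
  (forall m x1 x3 s, is_derive (s : R) 1 (fun s => Y m (x1, s, x3)) (dY m (x1,
    s, x3))) ->
  forall m, `|m| <= 1 -> \int[lebesgue3]_x dY m x = 0.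
Proof.
move=> Y' m m1; have [C [YC dYC]] := weight_bounds m m1.
by rewrite /Rintegral (integral_partial2 (Y m) (dY m) C (rdY.1 m)).
Qed.

Lemma rapid_integral_partial3 :
  (forall m x1 x2 s, is_derive (s : R) 1 (fun s => Y m (x1, x2, s)) (dY m (x1,
    x2, s))) ->
  forall m, `|m| <= 1 -> \int[lebesgue3]_x dY m x = 0.
Proof.
move=> Y' m m1; have [C [YC dYC]] := weight_bounds m m1.
by rewrite /Rintegral (integral_partial3 (Y m) (dY m) C (rdY.1 m)).
Qed.

End rapid_integral0.

Section integral_divergence.
Context {R : realType}.
Variables (D Y1 Y2 Y3 Z1 Z2 Z3 Q : R -> R3 R -> R) (c K m : R).
Hypotheses (rD0 : rapid D) (rY1 : rapid Y1) (rY2 : rapid Y2) (rY3 : rapid Y3)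
  (rZ1 : rapid Z1) (rZ2 : rapid Z2) (rZ3 : rapid Z3) (rQ : rapid Q).
Hypothesis m1 : `|m| <= 1.
Hypotheses (iY1 : \int[lebesgue3]_x Y1 m x =
  0) (iY2 : \int[lebesgue3]_x Y2 m x = 0)
  (iY3 : \int[lebesgue3]_x Y3 m x = 0) (iZ1 : \int[lebesgue3]_x Z1 m x = 0)
  (iZ2 : \int[lebesgue3]_x Z2 m x = 0) (iZ3 : \int[lebesgue3]_x Z3 m x = 0).
Hypothesis bound : forall x, `|D m x - (Y1 m x + Y2 m x + Y3 m x)|
  <= c * (Z1 m x + Z2 m x + Z3 m x) + K * Q m x.

Let intr (f : R -> R3 R -> R) (t : R) : rapid f -> `|t| <= 1 ->
  lebesgue3.-integrable setT (EFin \o f t).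
Proof. exact: rapid_integrable. Qed.

(** The pointwise bound is only available modulo divergences. Subtracting the [Yi] from [D] and
    adding the [Zi] to the majorant leaves both integrals unchanged. *)
Lemma integral_divergence_le : `|\int[lebesgue3]_x D m x| <=
  K * \int[lebesgue3]_x Q m x.
Proof.
pose dY m x := Y1 m x + Y2 m x + Y3 m x.
pose dZ m x := Z1 m x + Z2 m x + Z3 m x.
have rdY : rapid dY by apply: rapidD rY3; exact: rapidD rY1 rY2.
have rdZ : rapid dZ by apply: rapidD rZ3; exact: rapidD rZ1 rZ2.
have rD : rapid (fun m x => D m x - dY m x) by apply: rapidD => //; exact: rapidN.
have rK : rapid (fun m x => K * Q m x) by apply: rapidMl => //; exact: slow_cst.
have rcZ : rapid (fun m x => c * dZ m x) by apply: rapidMl => //; exact: slow_cst.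
have rS : rapid (fun m x => c * dZ m x + K * Q m x) by exact: rapidD.
have intY : \int[lebesgue3]_x dY m x = 0.
  rewrite RintegralD//; [|exact: (intr _ _ (rapidD _ _ rY1 rY2) m1)|exact: (intr
    _ _ rY3 m1)].
  rewrite RintegralD//; [|exact: (intr _ _ rY1 m1)|exact: (intr _ _ rY2 m1)].
  by rewrite iY1 iY2 iY3 !addr0.
have intZ : \int[lebesgue3]_x dZ m x = 0.
  rewrite RintegralD//; [|exact: (intr _ _ (rapidD _ _ rZ1 rZ2) m1)|exact: (intr
    _ _ rZ3 m1)].
  rewrite RintegralD//; [|exact: (intr _ _ rZ1 m1)|exact: (intr _ _ rZ2 m1)].
  by rewrite iZ1 iZ2 iZ3 !addr0.
have -> : \int[lebesgue3]_x D m x = \int[lebesgue3]_x (D m x - dY m x).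
  rewrite RintegralB ?intY ?subr0//;
    [exact: (intr _ _ rD0 m1)|exact: (intr _ _ rdY m1)].
have -> : K * \int[lebesgue3]_x Q m x =
    \int[lebesgue3]_x (c * dZ m x + K * Q m x).
  rewrite RintegralD//; [|exact: (intr _ _ rcZ m1)|exact: (intr _ _ rK m1)].
  rewrite RintegralZl//; [|exact: (intr _ _ rdZ m1)].
  by rewrite intZ mulr0 add0r RintegralZl//; exact: (intr _ _ rQ m1).
apply: (@le_trans _ _ (\int[lebesgue3]_x `|D m x - dY m x|)).
  by apply: le_normr_Rintegral => //; exact: (intr _ _ rD m1).
exact: (le_Rintegral measurableT (integrable_norm (intr _ _ rD m1))
  (intr _ _ rS m1) (fun x _ => bound x)).
Qed.

End integral_divergence.

Section rapid_Rintegral.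
Context {R : realType}.
Variables (f g : R -> R3 R -> R) (r m : R).
Hypotheses (rf : rapid f) (rg : rapid g) (m1 : `|m| <= 1).

Lemma rapid_Rintegral_le : (forall x, f m x <= g m x) ->
  \int[lebesgue3]_x f m x <= \int[lebesgue3]_x g m x.
Proof.
move=> fg; exact: (le_Rintegral measurableT (rapid_integrable _ _ rf m1)
  (rapid_integrable _ _ rg m1) (fun x _ => fg x)).
Qed.

Lemma rapid_RintegralZ_le : (forall x, r * f m x <= g m x) ->
  r * \int[lebesgue3]_x f m x <= \int[lebesgue3]_x g m x.
Proof.
move=> fg; have intf := rapid_integrable _ _ rf m1.
rewrite -RintegralZl//.
exact: (le_Rintegral measurableT (integrableZl measurableT r intf)
  (rapid_integrable _ _ rg m1) (fun x _ => fg x)).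
Qed.

End rapid_Rintegral.

Section rapid_derivative.
Context {R : realType}.
Variables (f df : R -> R3 R -> R).
Hypotheses (rf : rapid f) (rdf : rapid df)
  (f' : forall m x, is_derive (m : R) 1 (f ^~ x) (df m x)).

(** Differentiation under the integral: the bounds of [rapid] are uniform for slopes up to 1, which
    provides one integrable majorant on the open interval of slopes. *)
Lemma is_derive_rapid_integral (m : R) : `|m| < 1 ->
  is_derive m 1 (fun m => \int[lebesgue3]_x f m x) (\int[lebesgue3]_x df m x).
Proof.
move=> m1; have [C dC] := rapid_weight _ rdf.
have mI : `]-1, 1[%classic m by rewrite /= in_itv/= -ltr_norml.
have I1 (y : R) : `]-1, 1[%classic y -> `|y| <= 1.
  by rewrite /= in_itv/= -ltr_norml => /ltW.
have d1 y x : partial1of2 f y x = df y x.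
  by rewrite partial1of2E; have h := f' y x; rewrite derive_val.
have intG : lebesgue3.-integrable setT (EFin \o (fun x : R3 R => `|C| * weight3
  x)).
  exact: (integrableZl measurableT `|C| integrable_weight3).
have w0 (x : R3 R) : 0 <= weight3 x.
  by rewrite /weight3 !mulr_ge0// invr_ge0 ltW// oneDsqr_gt0.
have h1 y : `]-1, 1[%classic y -> lebesgue3.-integrable setT (EFin \o f y).
  by move=> yI; exact: (rapid_integrable _ _ rf (I1 _ yI)).
have h2 y x : `]-1, 1[%classic y -> setT x -> derivable (f ^~ x) y 1.
  by move=> _ _; have [] := f' y x.
have h3 x : 0 <= `|C| * weight3 x by rewrite mulr_ge0.
have h4 y x : `]-1, 1[%classic y -> setT x -> `|partial1of2 f y x| <=
  `|C| * weight3 x.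
  move=> yI _; rewrite d1 (le_trans (dC y x (I1 _ yI)))//.
  by rewrite ler_wpM2r// ler_norm.
apply: DeriveDef.
  exact: (derivable_under_integral measurableT mI h1 h2 h3 intG h4).
rewrite -derive1E (differentiation_under_integral measurableT mI h1 h2 h3 intG
  h4).
by apply: eq_Rintegral => x _; exact: d1.
Qed.

End rapid_derivative.

(** * Gronwall's lemma and coercivity of the flux *)

Section gronwall.
Context {R : realType}.

(** The product of [F] with [expR (L * m)] is nondecreasing. *)
Lemma gronwall_ge (F dF : R -> R) (L a b : R) :
  (forall m, a <= m <= b -> is_derive m 1 F (dF m)) ->
  (forall m, a <= m <= b -> 0 <= dF m + L * F m) ->
  a <= b -> F a <= expR (L * (b - a)) * F b.
Proof.
move=> F' FL ab; pose g m := F m * expR (L * m).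
have g' m : a <= m <= b -> is_derive m 1 g (dF m * expR (L * m) + F m * (L *
  expR (L * m))).
  move=> mab; apply: is_derive1M; first exact: F'.
  have h : is_derive m 1 (fun t => L * t) L.
    apply: (is_derive1_eq _ _ _ _ (is_derive1M _ _ _ _ _ (is_derive_cst L m 1)
      (is_derive_id m 1))).
    by rewrite mul0r mulr1 add0r.
  apply: (is_derive1_eq _ _ _ _ (is_derive1_comp (is_derive_expR _) h)).
  by rewrite mulrC.
have sub m : m \in `]a, b[ -> a <= m <= b.
  by rewrite in_itv/= => /andP[am mb]; rewrite !ltW.
have gab : g a <= g b.
  apply: (@ger0_derive1_ndecr _ g a b) => //.
  - by move=> m /sub/g'[].
  - move=> m /sub mab; rewrite derive1E; have h := g' m mab; rewrite derive_val.
    by rewrite mulrA -mulrDl (mulrC (F m)) mulr_ge0// ?expR_ge0// FL.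
  - apply: derivable_within_continuous => m; rewrite in_itv/= => mab.
    by have [] := g' m mab.
move: gab; rewrite /g -ler_pdivlMr ?expR_gt0// => /le_trans; apply.
by rewrite -mulrA -expRN -expRD mulrBr mulrC.
Qed.

Lemma gronwall_le (F dF : R -> R) (L a b : R) :
  (forall m : R, a <= m <= b -> is_derive m 1 F (dF m)) ->
  (forall m, a <= m <= b -> dF m <= L * F m) ->
  a <= b -> F b <= expR (L * (b - a)) * F a.
Proof.
move=> F' FL ab.
(* Changing the signs of both [F] and the rate turns the lower bound into the upper one. *)
have := gronwall_ge (fun m => - F m) (fun m => - dF m) (- L) a b.
have F1 (m : R) : a <= m <= b -> is_derive m 1 (fun m => - F m) (- dF m).
  by move=> mab; have h := F' m mab; exact: is_deriveN.
have F2 m : a <= m <= b -> 0 <= - dF m + - L * - F m.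
  by move=> mab; rewrite mulrNN addrC subr_ge0 FL.
move=> /(_ F1 F2 ab); rewrite mulNr expRN mulrN lerN2 -ler_pdivlMl ?invr_gt0
  ?expR_gt0//.
by rewrite invrK.
Qed.

(** A bound on the absolute value of the derivative controls growth and decrease alike, so either
    endpoint bounds the other; [main] is stated for an ordered pair to serve both signs of [m]. As
    [b <= 1], the length of the interval disappears from the exponential. *)
Lemma gronwall_abs (F dF : R -> R) (K b m : R) : 0 <= K -> b <= 1 ->
  (forall m, `|m| <= b -> 0 <= F m) ->
  (forall m : R, `|m| <= b -> is_derive m 1 F (dF m)) ->
  (forall m, `|m| <= b -> `|dF m| <= K * F m) ->
  `|m| <= b -> F m <= expR K * F 0 /\ F 0 <= expR K * F m.
Proof.
move=> K0 b1 F0 F' FK mb.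
have b0 : 0 <= b by exact: le_trans (normr_ge0 _) mb.
have z : `|0 : R| <= b by rewrite normr0.
have main (x y : R) : x <= y -> y - x <= 1 -> `|x| <= b -> `|y| <= b ->
    F y <= expR K * F x /\ F x <= expR K * F y.
  move=> xy yx1; rewrite !ler_norml => /andP[bx xb] /andP[by_ yb].
  have sub t : x <= t <= y -> `|t| <= b.
    by move=> /andP[xt ty]; rewrite ler_norml (le_trans bx)// (le_trans ty).
  have eK : expR (K * (y - x)) <= expR K by rewrite ler_expR ler_piMr.
  have mon u : `|u| <= b -> expR (K * (y - x)) * F u <= expR K * F u.
    by move=> ub; rewrite ler_wpM2r// F0.
  split.
    apply: (le_trans _ (mon _ _)); last by rewrite ler_norml bx.
    apply: (gronwall_le F dF) => // t /sub tb; first exact: F'.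
    by have := FK t tb; rewrite ler_norml => /andP[].
  apply: (le_trans _ (mon _ _)); last by rewrite ler_norml by_.
  apply: (gronwall_ge F dF) => // t /sub tb; first exact: F'.
  by have := FK t tb; rewrite ler_norml => /andP[h _]; rewrite -lerBlDr sub0r.
have := mb; rewrite ler_norml => /andP[h1 h2].
have [m0|m0] := leP 0 m; first by apply: main => //; lra.
have [||//|//|h3 h4] := main m 0; [lra|lra|by split].
Qed.

End gronwall.

(** The surface being spacelike, made quantitative: the cross term [a4 * a1] is at most [a / 2], and
    its coefficient is at most [b]. *)
Lemma coercive_pointwise {R : realFieldType} (b t a1 a2 a3 a4 : R) : `|t| <=
  b -> b <= 1 ->
  let a := a1 ^+ 2 + a2 ^+ 2 + a3 ^+ 2 + a4 ^+ 2 in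
  ((1 - b) / 2 * a <= a / 2 + t * (a4 * a1) /\ a / 2 + t * (a4 * a1) <= a).
Proof.
rewrite ler_norml => /andP[tb bt] b1 a.
have h1 := sqr_ge0 (a1 - a4); have h2 := sqr_ge0 (a1 + a4).
have h3 := sqr_ge0 a2; have h4 := sqr_ge0 a3.
have a14 : `|a4 * a1| <= a / 2 by rewrite ler_norml /a; lra.
have ta : `|t * (a4 * a1)| <= b * (a / 2).
  by rewrite normrM ler_pM// ler_norml tb.
have a0 : 0 <= a / 2 by exact: le_trans (normr_ge0 _) a14.
have ba : b * (a / 2) <= a / 2 by rewrite ler_piMl.
clearbody a; move: ta; rewrite ler_norml => /andP[ta1 ta2]. split; lra.
Qed.

(** * The weighted energy estimate, with constants free of the bound on phi *)

Section energy.
Context {R : realType}.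
Variables (u V : spacetime R -> R).
Hypotheses (su : smooth u) (du : fast_decay u) (uV : solves_wave V u).
Variables (phi psi : R -> R) (B : R).
Hypotheses (phi' : forall s : R, is_derive s 1 phi (psi s))
  (cpsi : continuous psi)
  (phi_bound : forall s, `|phi s| <= B)
  (phi_le : forall s, `|phi s| <= `|s|)
  (psi_le1 : forall s, `|psi s| <= 1).
Variables (k : R) (k0 : 0 <= k).

Local Notation fd := (field u phi).
Local Notation J x := (1 + (coord1 x ^+ 2 + coord2 x ^+ 2 + coord3 x ^+ 2)).

Let slow_phi : slow (fun (_ : R) (x : R3 R) => phi (coord1 x)).
Proof.
apply: (slow_bounded _ B) => [_|_ x _]; last exact: phi_bound.
move=> x; apply: (@continuous_comp _ _ _ (@coord1 R) phi).
  exact: continuous_coord1.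
exact: (continuous_phi phi psi phi').
Qed.

Let slow_psi : slow (fun (_ : R) (x : R3 R) => psi (coord1 x)).
Proof.
apply: (slow_bounded _ 1) => [_|_ x _]; last exact: psi_le1.
move=> x; apply: (@continuous_comp _ _ _ (@coord1 R) psi).
  exact: continuous_coord1.
exact: cpsi.
Qed.

Let rapid_fd ds : rapid (fd ds).
Proof. exact: (rapid_field _ su du _ _ _ phi' phi_bound). Qed.

(** Membership in the classes follows the syntax of the expression. For a rapid product one rapid
    factor suffices, and it is sought on the right before the left. *)
Ltac slow_tac := lazymatch goal with
  | |- slow (fun _ _ => ?c) => exact: (slow_cst c)
  | |- slow (fun m _ => m) => exact: slow_id
  | |- slow (fun _ x => coord1 x) => exact: slow_coord1
  | |- slow (fun _ x => coord2 x) => exact: slow_coord2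
  | |- slow (fun _ x => coord3 x) => exact: slow_coord3
  | |- slow (fun _ x => phi _) => exact: slow_phi
  | |- slow (fun _ x => psi _) => exact: slow_psi
  | |- slow (fun m x => field _ _ ?ds m x) => exact: (rapid_slow _ (rapid_fd ds))
  | |- slow (fun _ x => GRing.inv (GRing.exp _ 2)) => exact: slow_invJ2
  | |- slow (fun _ x => GRing.inv _) => exact: slow_invJ
  | |- slow (fun m x => @GRing.mul _ (@?f m x) (@?g m x)) =>
      refine (slowM f g _ _); slow_tac
  | |- slow (fun m x => @Algebra.add _ (@?f m x) (@?g m x)) =>
      refine (slowD f g _ _); slow_tac
  | |- slow (fun m x => @Algebra.opp _ (@?f m x)) => refine (slowN f _); slow_tac
  | |- slow (fun m x => @GRing.exp _ (@?f m x) ?n) => refine (slowX f n _);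
    slow_tac
  end.
Ltac rapid_tac := lazymatch goal with
  | |- rapid (fun m x => field _ _ ?ds m x) => exact: (rapid_fd ds)
  | |- rapid (fun m x => @Algebra.opp _ (@?f m x)) => refine (rapidN f _);
    rapid_tac
  | |- rapid (fun m x => @Algebra.add _ (@?f m x) (@?g m x)) =>
      refine (rapidD f g _ _); rapid_tac
  | |- rapid (fun m x => @GRing.exp _ (@?f m x) 2) => refine (rapidX2 f _);
    rapid_tac
  | |- rapid (fun m x => @GRing.mul _ (@?f m x) (@?g m x)) =>
      first [ refine (rapidMl f g _ _); [slow_tac | rapid_tac]
            | refine (rapidM f g _ _); [rapid_tac | slow_tac] ]
  end.

Let fd_m ds m x := is_derive_field_m u su phi ds m x.
Let fd_1 ds m x2 x3 s := is_derive_field1 u su phi psi phi' ds m x2 x3 s.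
Let fd_2 ds m x1 x3 s := is_derive_field2 u su phi ds m x1 x3 s.
Let fd_3 ds m x1 x2 s := is_derive_field3 u su phi ds m x1 x2 s.

Let J_neq0 (x1 x2 x3 : R) : 1 + (x1 ^+ 2 + x2 ^+ 2 + x3 ^+ 2) != 0.
Proof.
have := sqr_ge0 x1; have := sqr_ge0 x2; have := sqr_ge0 x3.
by move=> h1 h2 h3; rewrite gt_eqF//; lra.
Qed.

Ltac derive_tac leaf := lazymatch goal with
  | |- is_derive _ _ (fun _ => ?c) _ => exact: (is_derive_cst c _ _)
  | |- is_derive _ _ (fun t => t) _ => exact: is_derive_id
  | |- is_derive _ _ phi _ => exact: phi'
  | |- is_derive _ _ (fun t => phi t) _ => exact: phi'
  | |- is_derive _ _ (fun t => field _ _ _ _ _) _ => eapply leaf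
  | |- is_derive _ _ (fun t => @GRing.mul _ (@?f t) (@?g t)) _ =>
      eapply (is_derive1M f g); derive_tac leaf
  | |- is_derive _ _ (fun t => @Algebra.add _ (@?f t) (@?g t)) _ =>
      eapply (is_derive1D f g); derive_tac leaf
  | |- is_derive _ _ (fun t => @GRing.exp _ (@?f t) 2) _ =>
      eapply (is_derive1_sqr f); derive_tac leaf
  | |- is_derive _ _ (fun t => @GRing.inv _ (@?f t)) _ =>
      eapply (is_derive1V f); [exact: J_neq0 | derive_tac leaf]
  end.

Definition edens (m : R) (x : R3 R) : R :=
  fd [:: dir_x1] m x ^+ 2 + fd [:: dir_x2] m x ^+ 2 + fd [:: dir_x3] m x ^+ 2
  + fd [:: dir_t] m x ^+ 2.

(** [k = 0] is the energy itself, [k = 1] the weighted energy that controls the tails; keeping [k]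
    as a parameter treats both at once. *)
Definition wedens m x : R := (1 + k * coord1 x ^+ 2) * edens m x.

Lemma wedens_ge0 m x : 0 <= wedens m x.
Proof.
apply: mulr_ge0; first by rewrite addr_ge0// mulr_ge0 ?sqr_ge0.
by rewrite !addr_ge0 ?sqr_ge0.
Qed.

(* The flux of [(|grad u|^2 + u_t^2) / 2 , - u_t grad u] through the surface
   [t = m phi(x1)], whose conormal is [(1, - m psi(x1), 0, 0)]. *)
Definition flux (m : R) (x : R3 R) : R :=
  (1 + k * coord1 x ^+ 2) * (edens m x / 2
    + m * psi (coord1 x) * (fd [:: dir_t] m x * fd [:: dir_x1] m x)).

(** The derivative of the flux density in [m] at fixed [x]: every trace contributes phi times its
    time derivative, and the explicit factor [m] contributes the term in [psi] alone. *)
Definition dflux (m : R) (x : R3 R) : R :=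
  (1 + k * coord1 x ^+ 2) *
  (phi (coord1 x) * (fd [:: dir_x1] m x * fd [:: dir_t; dir_x1] m x
      + fd [:: dir_x2] m x * fd [:: dir_t; dir_x2] m x
      + fd [:: dir_x3] m x * fd [:: dir_t; dir_x3] m x
      + fd [:: dir_t] m x * fd [:: dir_t; dir_t] m x)
   + psi (coord1 x) * (fd [:: dir_t] m x * fd [:: dir_x1] m x)
   + m * psi (coord1 x) * phi (coord1 x) *
      (fd [:: dir_t; dir_t] m x * fd [:: dir_x1] m x
       + fd [:: dir_t] m x * fd [:: dir_t; dir_x1] m x)).

Lemma rapid_wedens : rapid wedens.
Proof. rewrite /wedens /edens; rapid_tac. Qed.

Let rapid_flux : rapid flux.
Proof. rewrite /flux /edens; rapid_tac. Qed.

Let rapid_dflux : rapid dflux.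
Proof. rewrite /dflux; rapid_tac. Qed.

Ltac gen_fields := repeat match goal with
  | |- context [field u phi ?ds ?m ?x] =>
      let f := fresh "f" in move: (field u phi ds m x) => f end.

Let is_derive_flux (m : R) x : is_derive m 1 (flux ^~ x) (dflux m x).
Proof.
rewrite /flux /edens; eapply is_derive1_eq; first by derive_tac fd_m.
rewrite /dflux; gen_fields; by field.
Qed.

(* [Y1, Y2, Y3] is the part in divergence form of the derivative of the flux, and
   [Z1, Z2, Z3] is the vector field of Hardy's inequality; [dYi] and [dZi] are the
   total derivatives along [xi] on the surface. *)
Let Y1 m x := (1 + k * coord1 x ^+ 2) * phi (coord1 x)
  * (fd [:: dir_t] m x * fd [:: dir_x1] m x).
Let dY1 m x := (2 * k * coord1 x * phi (coord1 x)
    + (1 + k * coord1 x ^+ 2) * psi (coord1 x))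
    * (fd [:: dir_t] m x * fd [:: dir_x1] m x)
  + (1 + k * coord1 x ^+ 2) * phi (coord1 x)
    * ((fd [:: dir_x1; dir_t] m x + m * psi (coord1 x) * fd [:: dir_t; dir_t] m x)
         * fd [:: dir_x1] m x
       + fd [:: dir_t] m x * (fd [:: dir_x1; dir_x1] m x
           + m * psi (coord1 x) * fd [:: dir_t; dir_x1] m x)).
Let Y2 m x := (1 + k * coord1 x ^+ 2) * phi (coord1 x)
  * (fd [:: dir_t] m x * fd [:: dir_x2] m x).
Let dY2 m x := (1 + k * coord1 x ^+ 2) * phi (coord1 x)
  * (fd [:: dir_x2; dir_t] m x * fd [:: dir_x2] m x
     + fd [:: dir_t] m x * fd [:: dir_x2; dir_x2] m x).
Let Y3 m x := (1 + k * coord1 x ^+ 2) * phi (coord1 x)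
  * (fd [:: dir_t] m x * fd [:: dir_x3] m x).
Let dY3 m x := (1 + k * coord1 x ^+ 2) * phi (coord1 x)
  * (fd [:: dir_x3; dir_t] m x * fd [:: dir_x3] m x
     + fd [:: dir_t] m x * fd [:: dir_x3; dir_x3] m x).
Let Z1 m x := (1 + k * coord1 x ^+ 2) * (fd [::] m x ^+ 2 * (coord1 x * (J
  x)^-1)).
Let dZ1 m x := 2 * k * coord1 x ^+ 2 * fd [::] m x ^+ 2 * (J x)^-1
  + (1 + k * coord1 x ^+ 2)
    * (2 * fd [::] m x
         * ((fd [:: dir_x1] m x + m * psi (coord1 x) * fd [:: dir_t] m x) *
           coord1 x)
         * (J x)^-1
       + fd [::] m x ^+ 2 * ((J x)^-1 + - (2 * coord1 x ^+ 2 * (J x ^+ 2)^-1))).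
Let Z2 m x := (1 + k * coord1 x ^+ 2) * (fd [::] m x ^+ 2 * (coord2 x * (J
  x)^-1)).
Let dZ2 m x := (1 + k * coord1 x ^+ 2)
    * (2 * fd [::] m x * (fd [:: dir_x2] m x * coord2 x) * (J x)^-1
       + fd [::] m x ^+ 2 * ((J x)^-1 + - (2 * coord2 x ^+ 2 * (J x ^+ 2)^-1))).
Let Z3 m x := (1 + k * coord1 x ^+ 2) * (fd [::] m x ^+ 2 * (coord3 x * (J
  x)^-1)).
Let dZ3 m x := (1 + k * coord1 x ^+ 2)
    * (2 * fd [::] m x * (fd [:: dir_x3] m x * coord3 x) * (J x)^-1
       + fd [::] m x ^+ 2 * ((J x)^-1 + - (2 * coord3 x ^+ 2 * (J x ^+ 2)^-1))).

Let rY1 : rapid Y1. Proof. rewrite /Y1; rapid_tac. Qed.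
Let rdY1 : rapid dY1. Proof. rewrite /dY1; rapid_tac. Qed.
Let rY2 : rapid Y2. Proof. rewrite /Y2; rapid_tac. Qed.
Let rdY2 : rapid dY2. Proof. rewrite /dY2; rapid_tac. Qed.
Let rY3 : rapid Y3. Proof. rewrite /Y3; rapid_tac. Qed.
Let rdY3 : rapid dY3. Proof. rewrite /dY3; rapid_tac. Qed.
Let rZ1 : rapid Z1. Proof. rewrite /Z1; rapid_tac. Qed.
Let rdZ1 : rapid dZ1. Proof. rewrite /dZ1; rapid_tac. Qed.
Let rZ2 : rapid Z2. Proof. rewrite /Z2; rapid_tac. Qed.
Let rdZ2 : rapid dZ2. Proof. rewrite /dZ2; rapid_tac. Qed.
Let rZ3 : rapid Z3. Proof. rewrite /Z3; rapid_tac. Qed.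
Let rdZ3 : rapid dZ3. Proof. rewrite /dZ3; rapid_tac. Qed.

Let int_dY1 m : `|m| <= 1 -> \int[lebesgue3]_x dY1 m x = 0.
Proof.
apply: (rapid_integral_partial1 Y1 dY1 rY1 rdY1) => {}m x2 x3 s.
rewrite /Y1 /dY1 /coord1 /coord2 /coord3 /fst /snd.
eapply is_derive1_eq; first by derive_tac fd_1.
by gen_fields; ring.
Qed.

Let int_dY2 m : `|m| <= 1 -> \int[lebesgue3]_x dY2 m x = 0.
Proof.
apply: (rapid_integral_partial2 Y2 dY2 rY2 rdY2) => {}m x1 x3 s.
rewrite /Y2 /dY2 /coord1 /coord2 /coord3 /fst /snd.
eapply is_derive1_eq; first by derive_tac fd_2.
by gen_fields; ring.
Qed.

Let int_dY3 m : `|m| <= 1 -> \int[lebesgue3]_x dY3 m x = 0.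
Proof.
apply: (rapid_integral_partial3 Y3 dY3 rY3 rdY3) => {}m x1 x2 s.
rewrite /Y3 /dY3 /coord1 /coord2 /coord3 /fst /snd.
eapply is_derive1_eq; first by derive_tac fd_3.
by gen_fields; ring.
Qed.

Let int_dZ1 m : `|m| <= 1 -> \int[lebesgue3]_x dZ1 m x = 0.
Proof.
apply: (rapid_integral_partial1 Z1 dZ1 rZ1 rdZ1) => {}m x2 x3 s.
rewrite /Z1 /dZ1 /coord1 /coord2 /coord3 /fst /snd.
eapply is_derive1_eq; first by derive_tac fd_1.
by gen_fields; field; exact: J_neq0.
Qed.

Let int_dZ2 m : `|m| <= 1 -> \int[lebesgue3]_x dZ2 m x = 0.
Proof.
apply: (rapid_integral_partial2 Z2 dZ2 rZ2 rdZ2) => {}m x1 x3 s.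
rewrite /Z2 /dZ2 /coord1 /coord2 /coord3 /fst /snd.
eapply is_derive1_eq; first by derive_tac fd_2.
by gen_fields; field; exact: J_neq0.
Qed.

Let int_dZ3 m : `|m| <= 1 -> \int[lebesgue3]_x dZ3 m x = 0.
Proof.
apply: (rapid_integral_partial3 Z3 dZ3 rZ3 rdZ3) => {}m x1 x2 s.
rewrite /Z3 /dZ3 /coord1 /coord2 /coord3 /fst /snd.
eapply is_derive1_eq; first by derive_tac fd_3.
by gen_fields; field; exact: J_neq0.
Qed.

Variables (c b : R).
Hypotheses (c0 : 0 <= c) (b0 : 0 <= b) (b1 : b < 1)
  (V_bound : forall m x, `|m| <= b -> `|V (x, m * phi (coord1 x))| <= c / J x).

Let K := (9 * c + 2) / (1 - b).

(** Symmetry of the second derivatives cancels all terms in [psi] and the mixed ones; what is left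
    is [X phi u_t] times the wave operator, which the equation replaces by [- V u], and the
    derivative of the weight [X]. *)
Let dflux_bound m x : `|m| <= b ->
  `|dflux m x - (dY1 m x + dY2 m x + dY3 m x)|
  <= c * (dZ1 m x + dZ2 m x + dZ3 m x) + K * flux m x.
Proof.
move=> mb; set z := (x, m * phi (coord1 x)).
have S1 : fd [:: dir_x1; dir_t] m x = fd [:: dir_t;
  dir_x1] m x by exact: partial_comm.
have S2 : fd [:: dir_x2; dir_t] m x = fd [:: dir_t;
  dir_x2] m x by exact: partial_comm.
have S3 : fd [:: dir_x3; dir_t] m x = fd [:: dir_t;
  dir_x3] m x by exact: partial_comm.
have W : fd [:: dir_t; dir_t] m x - (fd [:: dir_x1; dir_x1] m x
    + fd [:: dir_x2; dir_x2] m x + fd [:: dir_x3; dir_x3] m x)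
    + V z * fd [::] m x = 0 by exact: uV.
have {}W : fd [:: dir_t; dir_t] m x = fd [:: dir_x1; dir_x1] m x
    + fd [:: dir_x2; dir_x2] m x + fd [:: dir_x3; dir_x3] m x - V z * fd [::] m x.
  exact: addr_eq0_subr W.
have := flux_pointwise k c b (phi (coord1 x)) (psi (coord1 x)) m
  (coord1 x) (coord2 x) (coord3 x) (fd [::] m x) (fd [:: dir_x1] m x)
  (fd [:: dir_x2] m x) (fd [:: dir_x3] m x) (fd [:: dir_t] m x) (V z)
  k0 c0 b1 mb (psi_le1 _) (phi_le _) (V_bound m x mb).
congr is_true; congr (`|_| <= _).
  rewrite /dflux /dY1 /dY2 /dY3 S1 S2 S3 W.
  gen_fields; ring.
rewrite /dZ1 /dZ2 /dZ3 /flux /edens -/K.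
gen_fields; ring.
Qed.

Let dflux_integral m : `|m| <= b ->
  `|\int[lebesgue3]_x dflux m x| <= K * \int[lebesgue3]_x flux m x.
Proof.
move=> mb; have m1 : `|m| <= 1 by rewrite (le_trans mb)// ltW.
exact: (integral_divergence_le dflux dY1 dY2 dY3 dZ1 dZ2 dZ3 flux c K m
  rapid_dflux rdY1 rdY2 rdY3 rdZ1 rdZ2 rdZ3 rapid_flux m1
  (int_dY1 m m1) (int_dY2 m m1) (int_dY3 m m1)
  (int_dZ1 m m1) (int_dZ2 m m1) (int_dZ3 m m1) (fun x => dflux_bound m x mb)).
Qed.

(** Gronwall is applied to the flux, which bounds its own derivative; energies enter only at the two
    ends. Flux is at most energy with constant 1, so the coercivity constant is paid for once. *)
Lemma weighted_energy_equiv m : `|m| <= b ->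
  \int[lebesgue3]_x wedens m x
    <= 2 / (1 - b) * expR K * \int[lebesgue3]_x wedens 0 x /\
  \int[lebesgue3]_x wedens 0 x
    <= 2 / (1 - b) * expR K * \int[lebesgue3]_x wedens m x.
Proof.
move=> mb.
have K0 : 0 <= K by rewrite /K divr_ge0// ?subr_ge0 ?(ltW b1)// addr_ge0//
  mulr_ge0.
have bm1 (y : R) : `|y| <= b -> `|y| <= 1 by move=> yb;
  rewrite (le_trans yb)// ltW.
have b0b : `|0 : R| <= b by rewrite normr0.
have coercive (y : R) : `|y| <= b ->
    (1 - b) / 2 * \int[lebesgue3]_x wedens y x <= \int[lebesgue3]_x flux y x
    <= \int[lebesgue3]_x wedens y x.
  move=> yb; have y1 := bm1 y yb.
  have pt (x : R3 R) : (1 - b) / 2 * wedens y x <= flux y x <= wedens y x.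
    rewrite /flux /wedens; set X := 1 + k * _.
    have X0 : 0 <= X.
      by apply: addr_ge0 => //; apply: mulr_ge0 => //; exact: sqr_ge0.
    have ms : `|y * psi (coord1 x)| <= b by rewrite normrM -(mulr1 b) ler_pM.
    have [h1 h2] := coercive_pointwise b (y * psi (coord1 x)) (fd [:: dir_x1] y x)
      (fd [:: dir_x2] y x) (fd [:: dir_x3] y x) (fd [:: dir_t] y x) ms (ltW b1).
    apply/andP; split; first by rewrite mulrCA; exact: ler_wpM2l.
    exact: ler_wpM2l.
  apply/andP; split.
    exact: (rapid_RintegralZ_le _ _ _ _ rapid_wedens rapid_flux y1 (fun x =>
      (andP (pt x)).1)).
  exact: (rapid_Rintegral_le _ _ _ rapid_flux rapid_wedens y1 (fun x => (andP
    (pt x)).2)).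
have [h1 h2] : \int[lebesgue3]_x flux m x <=
  expR K * \int[lebesgue3]_x flux 0 x /\
    \int[lebesgue3]_x flux 0 x <= expR K * \int[lebesgue3]_x flux m x.
  apply: (gronwall_abs (fun m => \int[lebesgue3]_x flux m x)
    (fun m => \int[lebesgue3]_x dflux m x) K b) => // [|y yb|y yb].
  - exact: ltW.
  - have /andP[cy _] := coercive y yb; apply: le_trans cy.
    rewrite mulr_ge0 ?divr_ge0 ?subr_ge0 ?(ltW b1)//.
    by apply: Rintegral_ge0 => x _; exact: wedens_ge0.
  - apply: (is_derive_rapid_integral flux dflux rapid_flux rapid_dflux
    is_derive_flux).
    exact: le_lt_trans yb b1.
have /andP[cm1 cm2] := coercive m mb; have /andP[c01 c02] := coercive 0 b0b.
have sb : 0 < 1 - b by rewrite subr_gt0.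
have eK := expR_gt0 K.
have half (p q r : R) : (1 - b) / 2 * p <= q -> q <= expR K * r -> p <=
  2 / (1 - b) * expR K * r.
  move=> h3 h4; have : (1 - b) / 2 * p <= expR K * r by exact: le_trans h4.
  rewrite -ler_pdivlMl ?divr_gt0// => /le_trans; apply.
  by rewrite invf_div mulrA.
split.
  by apply: half cm1 _; rewrite (le_trans h1)// ler_pM2l.
by apply: half c01 _; rewrite (le_trans h2)// ler_pM2l.
Qed.

End energy.

(** * The cutoff *)

Section cutoff.
Context {R : realType}.
Implicit Types s t : R.

(** The slope function of Caratheodory's criterion differs from [a] by at most the distance to [x].
    This differentiates the square of the positive part at its gluing point without one-sided
    limits. *)
Lemma is_derive1_quadratic (f : R -> R) (x a : R) :
  (forall z, `|f z - f x - a * (z - x)| <= (z - x) ^+ 2) -> is_derive x 1 f a.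
Proof.
move=> fxa; apply/is_derive1_caratheodory.
pose g z := if z == x then a else (f z - f x) / (z - x).
exists g; split.
- move=> z; rewrite /g; case: eqP => [->|/eqP zx]; first by rewrite !subrr mulr0.
  by rewrite divfK// subr_eq0.
- apply/cvgrPdist_le => e e0; near=> z.
  have zxe : `|x - z| <= e by near: z; exact: (cvgrPdist_le _ _).1 cvg_id _ e0.
  rewrite /g eqxx; case: eqP => [_|/eqP zx]; first by rewrite subrr normr0 ltW.
  have zx0 : z - x != 0 by rewrite subr_eq0.
  have zx1 : 0 < `|z - x| by rewrite normr_gt0.
  have -> : a - (f z - f x) / (z - x) = - (f z - f x - a * (z - x)) / (z - x).
    by field.
  rewrite normrM normrN normfV ler_pdivrMr// (le_trans (fxa z))//.
  rewrite -real_normK ?num_real// expr2 ler_wpM2r// distrC.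
- by rewrite /g eqxx.
Unshelve. all: end_near. Qed.

Definition pospart t : R := (t + `|t|) / 2.

Lemma pospartE t : pospart t = if t <= 0 then 0 else t.
Proof.
rewrite /pospart; case: ifPn => [t0|]; first by rewrite ler0_norm// subrr mul0r.
by rewrite -ltNge => t0; rewrite gtr0_norm//; field.
Qed.

Lemma continuous_pospart : continuous pospart.
Proof.
move=> t; apply: cvgM; last exact: cvg_cst.
by apply: cvgD; [exact: cvg_id|exact: norm_continuous].
Qed.

Lemma is_derive_sqr_pospart t : is_derive t 1 (fun s => pospart s ^+ 2) (2 *
  pospart t).
Proof.
apply: is_derive1_quadratic => z; rewrite !pospartE ler_norml.
have zt := sqr_ge0 (z - t); have z2 := sqr_ge0 z; have t2 := sqr_ge0 t.
have [z0|z0] := leP z 0; have [t0|t0] := leP t 0.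
- by rewrite expr0n/= subrr mulr0 mul0r subr0 oppr_le0 zt.
- have := mulr_ge0 (ltW t0) (_ : 0 <= - z); rewrite oppr_ge0 => /(_ z0) tz.
  by apply/andP; split; lra.
- have := mulr_ge0 (ltW z0) (_ : 0 <= - t); rewrite oppr_ge0 => /(_ t0) tz.
  by apply/andP; split; lra.
- by apply/andP; split; lra.
Qed.

(* [ramp t] and [t] have bounded difference for [t >= 0], so that [cutoff] below
  is
   bounded. *)
Definition ramp t : R := Num.sqrt (1 + pospart t ^+ 2) - 1.
Definition dramp t : R := pospart t / Num.sqrt (1 + pospart t ^+ 2).

Let sqrt_gt0 t : 0 < Num.sqrt (1 + pospart t ^+ 2).
Proof. by rewrite sqrtr_gt0 ltr_wpDr// sqr_ge0. Qed.

Lemma pospart_ge0 t : 0 <= pospart t.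
Proof. by rewrite pospartE; case: ifPn => //; rewrite -ltNge => /ltW. Qed.

Lemma is_derive_ramp t : is_derive t 1 ramp (dramp t).
Proof.
have h := is_derive1D _ _ _ _ _ (is_derive_cst (1 : R) t 1)
  (is_derive_sqr_pospart t).
have p0 : 0 < 1 + pospart t ^+ 2 by rewrite ltr_wpDr// sqr_ge0.
have hs := @is_derive1_comp _ Num.sqrt (fun s => 1 + pospart s ^+ 2) _ _ _
  (is_derive1_sqrt p0) h.
have := is_derive1D _ _ _ _ _ hs (is_derive_cst (-1 : R) t 1).
move=> /is_derive1_eq; apply.
by rewrite /dramp addr0 add0r; field; rewrite gt_eqF.
Qed.

Lemma continuous_dramp : continuous dramp.
Proof.
move=> t; apply: cvgM; first exact: continuous_pospart.
apply: cvgV; first by rewrite gt_eqF.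
apply: (@continuous_comp _ _ _ (fun t => 1 + pospart t ^+ 2) Num.sqrt);
  last exact: sqrt_continuous.
apply: cvgD; first exact: cvg_cst.
by apply: cvgM; exact: continuous_pospart.
Qed.

Lemma dramp_itv t : 0 <= dramp t <= 1.
Proof.
rewrite /dramp divr_ge0 ?pospart_ge0 ?sqrtr_ge0//= ler_pdivrMr// mul1r.
rewrite -[leLHS](ger0_norm (pospart_ge0 t)) -sqrtr_sqr ler_wsqrtr//; lra.
Qed.

Lemma ramp_itv t : 0 <= ramp t <= pospart t.
Proof.
have p0 := pospart_ge0 t.
have h : 1 <= Num.sqrt (1 + pospart t ^+ 2).
  by rewrite -[leLHS]sqrtr1 ler_wsqrtr// lerDl sqr_ge0.
rewrite subr_ge0 h/= lerBlDr.
have q0 : 0 <= pospart t + 1 by rewrite addr_ge0.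
rewrite -[leRHS](ger0_norm q0) -sqrtr_sqr ler_wsqrtr//; nra.
Qed.

Lemma ramp_ge t : 0 <= t -> t - 1 <= ramp t.
Proof.
move=> t0; rewrite lerD2r -[leLHS](ger0_norm t0) -sqrtr_sqr ler_wsqrtr//.
rewrite pospartE; case: ifPn => t1; last lra.
have -> : t = 0 by lra.
lra.
Qed.

Lemma ramp_eq0 t : t <= 0 -> ramp t = 0.
Proof. by move=> t0; rewrite /ramp pospartE t0 expr0n addr0 sqrtr1 subrr. Qed.

Lemma dramp_eq0 t : t <= 0 -> dramp t = 0.
Proof. by move=> t0; rewrite /dramp pospartE t0 mul0r. Qed.

(** For [n >= 0], an odd nondecreasing C^1 function that is the identity on [-n, n] and tends to n +
    1 at infinity. One continuous derivative is enough, since the divergence fields contain phi but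
    not its derivative. *)
Definition cutoff n s : R := s - ramp (s - n) + ramp (- s - n).
Definition dcutoff n s : R := 1 - dramp (s - n) - dramp (- s - n).

Variable n : R.
Hypothesis n0 : 0 <= n.

Lemma is_derive_cutoff s : is_derive s 1 (cutoff n) (dcutoff n s).
Proof.
have h1 : is_derive s 1 (fun s => s - n) 1.
  apply: (is_derive1_eq _ _ _ _ (is_derive1D _ _ _ _ _ (is_derive_id s 1)
    (is_derive_cst (- n) s 1))).
  by rewrite addr0.
have h2 : is_derive s 1 (fun s => - s - n) (-1).
  have h := is_derive1M _ _ _ _ _ (is_derive_cst (-1 : R) s 1) (is_derive_id s 1).
  have -> : (fun s => - s - n) = (fun s => -1 * s - n) by apply/funext => t;
    rewrite mulN1r.
  apply: (is_derive1_eq _ _ _ _ (is_derive1D _ _ _ _ _ h (is_derive_cst (- n) s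
    1))).
  by rewrite addr0 mul0r add0r mulr1.
have r1 := @is_derive1_comp _ ramp (fun s => s - n) _ _ _ (is_derive_ramp (s -
  n)) h1.
have r2 := @is_derive1_comp _ ramp (fun s => - s - n) _ _ _ (is_derive_ramp (- s
  - n)) h2.
have h3 := is_derive1M _ _ _ _ _ (is_derive_cst (-1 : R) s 1) r1.
have h4 := is_derive1D _ _ _ _ _ (is_derive1D _ _ _ _ _ (is_derive_id s 1) h3) r2.
have -> : cutoff n = (fun t => t + -1 * (ramp \o (fun s => s - n)) t + (ramp \o
  (fun s => - s - n)) t).
  by apply/funext => t; rewrite /cutoff mulN1r.
apply: (is_derive1_eq _ _ _ _ h4).
by rewrite /dcutoff /=; ring.
Qed.

Lemma continuous_dcutoff : continuous (dcutoff n).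
Proof.
move=> s; apply: cvgB; first apply: cvgB; first exact: cvg_cst.
- apply: (@continuous_comp _ _ _ (fun s => s - n) dramp);
  last exact: continuous_dramp.
  by apply: cvgB; [exact: cvg_id|exact: cvg_cst].
- apply: (@continuous_comp _ _ _ (fun s => - s - n) dramp);
  last exact: continuous_dramp.
  by apply: cvgB; [apply: cvgN; exact: cvg_id|exact: cvg_cst].
Qed.

Lemma cutoff_id s : `|s| <= n -> cutoff n s = s.
Proof.
rewrite ler_norml => /andP[h1 h2]; rewrite /cutoff !ramp_eq0 ?subr0 ?addr0//;
  move: n0 h1 h2; lra.
Qed.

Lemma dcutoff_le1 s : `|dcutoff n s| <= 1.
Proof.
rewrite /dcutoff; have /andP[h1 h2] := dramp_itv (s - n).
have /andP[h3 h4] := dramp_itv (- s - n).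
have [s0|s0] := leP 0 s.
  have -> : dramp (- s - n) = 0 by apply: dramp_eq0; move: n0 s0; lra.
  by rewrite ler_norml; apply/andP; split; lra.
have -> : dramp (s - n) = 0 by apply: dramp_eq0; move: n0 s0; lra.
by rewrite ler_norml; apply/andP; split; lra.
Qed.

Lemma cutoff_bounds s : `|cutoff n s| <= `|s| /\ `|cutoff n s| <= n + 1.
Proof.
have main t : 0 <= t -> 0 <= t - ramp (t - n) <= t /\ t - ramp (t - n) <= n + 1.
  move=> t0; have /andP[h1 h2] := ramp_itv (t - n).
  have [tn|tn] := leP (t - n) 0; first by rewrite ramp_eq0//; split; lra.
  have := ramp_ge _ (ltW tn).
  move: h2; rewrite pospartE; case: ifPn => [|_ h2 h3]; first by rewrite leNgt tn.
  by move: n0 => ?; split; [apply/andP; split|]; lra.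
have [s0|s0] := leP 0 s.
  have [/andP[h1 h2] h3] := main s s0.
  rewrite /cutoff (ramp_eq0 (- s - n)) ?addr0; last by move: n0 s0; lra.
  by rewrite !ger0_norm.
have [|/andP[h1 h2] h3] := main (- s); first lra.
rewrite /cutoff (ramp_eq0 (s - n)) ?subr0; last by move: n0 s0; lra.
have -> : s + ramp (- s - n) = - (- s - ramp (- s - n)) by ring.
by rewrite normrN ger0_norm// ltr0_norm.
Qed.

End cutoff.

(** * Removing the cutoff *)

Section comparison.
Context {R : realType}.
Local Notation T3 := (measurableTypeR R * measurableTypeR R * measurableTypeR
  R)%type.

Lemma EFin_Rintegral {d} {T : measurableType d} (mu : {measure set T -> \bar R})
    (f : T -> R) : mu.-integrable setT (EFin \o f) ->
  (\int[mu]_x f x)%:E = (\int[mu]_x (f x)%:E)%E.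
Proof. by move=> intf; rewrite /Rintegral fineK//; exact: integrable_fin_num. Qed.

Variables (u V : spacetime R -> R) (v C0 : R).
Hypotheses (su : smooth u) (du : fast_decay u) (uV : solves_wave V u)
  (hv : `|v| < 1)
  (hV : forall (m : R) (x : R3 R), 0 <= `|m| -> `|m| <= `|v| ->
     `|V (x, m * coord1 x)| <= C0 / japanese x ^+ 2).

Let C := 2 / (1 - `|v|) * expR ((9 * `|C0| + 2) / (1 - `|v|)).

(** A point of the truncated surface also lies on a plane t = m' x1 with |m'| <= |m|, namely m' = m
    phi(x1) / x1, so the assumed decay applies there. For x1 = 0 the bound on phi forces phi(x1) =
    0. *)
Let V_bound (phi : R -> R) : (forall s, `|phi s| <= `|s|) ->
  forall (m : R) (x : R3 R), `|m| <= `|v| ->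
  `|V (x, m * phi (coord1 x))| <=
    `|C0| / (1 + (coord1 x ^+ 2 + coord2 x ^+ 2 + coord3 x ^+ 2)).
Proof.
move=> phi_le m x mv.
have [m' m'v ->] : exists2 m' : R, `|m'| <=
  `|v| & m * phi (coord1 x) = m' * coord1 x.
  have [x0|x0] := eqVneq (coord1 x) 0.
    exists 0; first by rewrite normr0.
    have := phi_le (coord1 x); rewrite x0 normr0 normr_le0 => /eqP ->.
    by rewrite !mulr0.
  exists (m * (phi (coord1 x) / coord1 x)); last by rewrite -mulrA divfK.
  rewrite normrM (le_trans _ mv)// ler_piMr// normrM normfV.
  by rewrite ler_pdivrMr ?normr_gt0// mul1r.
rewrite (le_trans (hV m' x (normr_ge0 _) m'v))// sqr_japanese.
rewrite ler_wpM2r ?ler_norm// invr_ge0 addr_ge0// !addr_ge0 ?sqr_ge0//.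
Qed.

(** The radius [n.+1] is positive, so that [n.+1%:R ^- 2] below is a true inverse also for
    [n = 0]. *)
Let phi (n : nat) : R -> R := cutoff n.+1%:R.

Let phi_le n s : `|phi n s| <= `|s|.
Proof. by have [] := cutoff_bounds n.+1%:R (ler0n _ _) s. Qed.

Let phi_bound n s : `|phi n s| <= n.+1%:R + 1.
Proof. by have [] := cutoff_bounds n.+1%:R (ler0n _ _) s. Qed.

Let W (k : R) n m : R3 R -> R := wedens u (phi n) k m.

Let rapid_W k n : rapid (W k n).
Proof.
exact: (rapid_wedens u su du (phi n) _ _ (is_derive_cutoff _) (phi_bound n) k).
Qed.

Let v1 : `|v| <= 1. Proof. exact: ltW. Qed.

Let int_W k n m : `|m| <= 1 -> lebesgue3.-integrable setT (EFin \o W k n m).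
Proof. exact: rapid_integrable. Qed.

Let W_equiv k n : 0 <= k ->
  (\int[lebesgue3]_x (W k n v x)%:E <=
    C%:E * \int[lebesgue3]_x (W k n 0 x)%:E)%E /\
  (\int[lebesgue3]_x (W k n 0 x)%:E <= C%:E * \int[lebesgue3]_x (W k n v x)%:E)%E.
Proof.
move=> k0; have z1 : `|0 : R| <= 1 by rewrite normr0.
have := weighted_energy_equiv u V su du uV (phi n) _ _ (is_derive_cutoff _)
  (continuous_dcutoff _) (phi_bound n) (phi_le n) (dcutoff_le1 _ (ler0n _ _)) k k0
  `|C0| `|v| (normr_ge0 _) (normr_ge0 _) hv (V_bound _ (phi_le n)) v (lexx _).
rewrite -!EFin_Rintegral ?lee_fin; [|exact: int_W|exact: int_W].
by [].
Qed.

(** Slope 0 gives the surface t = 0 whatever the cutoff: the initial energies, plain or weighted, do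
    not depend on [n]. *)
Let W0E k n x : W k n 0 x = wedens u id k 0 x.
Proof. by rewrite /W /wedens /edens /field !mul0r. Qed.

(** The energy density on the true surface t = v x1. No decay is known for it, so it is only handled
    as a nonnegative measurable function. *)
Let G : R3 R -> R := edens u id v.

Let continuous_G : continuous G.
Proof.
have cf ds := continuous_field u su id ds v (fun x => cvg_id).
have c2 ds : continuous (fun x => field u id ds v x ^+ 2).
  by move=> x; apply: cvgM; exact: cf.
move=> x; apply: cvgD; last exact: c2.
by apply: cvgD; last exact: c2; apply: cvgD; exact: c2.
Qed.

Let G_ge0 x : 0 <= G x.
Proof. by rewrite /G /edens !addr_ge0 ?sqr_ge0. Qed.

Let W_G n (x : R3 R) : `|coord1 x| <= n.+1%:R -> W 0 n v x = G x.
Proof.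
move=> xn; rewrite /W /wedens mul0r addr0 mul1r /G /edens /field.
by rewrite [phi n _]cutoff_id.
Qed.

(** A Chebyshev argument: where the two surfaces differ, the weight [1 + x1^2] exceeds
    [n.+1%:R ^+ 2]. *)
Let G_W n (x : R3 R) : W 0 n v x <= G x + n.+1%:R ^- 2 * W 1 n v x.
Proof.
have W1 : 0 <= W 1 n v x by apply: wedens_ge0; rewrite ?ler01.
have [xn|xn] := leP `|coord1 x| n.+1%:R.
  by rewrite W_G// lerDl mulr_ge0.
rewrite (le_trans _ (_ : n.+1%:R ^- 2 * W 1 n v x <= _))//; last by rewrite lerDr.
rewrite ler_pdivlMl ?exprn_gt0//.
rewrite /W /wedens mul0r addr0 !mul1r ler_wpM2r//.
  by rewrite /edens !addr_ge0 ?sqr_ge0.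
have : n.+1%:R ^+ 2 <= coord1 x ^+ 2.
  by rewrite -(real_normK (num_real (coord1 x))) ler_sqr ?nnegrE// ltW.
lra.
Qed.

Let slantedE : slanted_energy v u = (\int[lebesgue3]_x (G x)%:E)%E.
Proof. by []. Qed.

Let slanted0E n : slanted_energy 0 u = (\int[lebesgue3]_x (W 0 n 0 x)%:E)%E.
Proof.
have WE x : W 0 n 0 x = edens u id 0 x.
  by rewrite W0E /wedens mul0r addr0 mul1r.
rewrite /slanted_energy; apply: eq_integral => x _.
rewrite WE /edens /field /sqnorm_grad.
exact: erefl.
Qed.

Let W_equiv0 n :
  (\int[lebesgue3]_x (W 0 n v x)%:E <= C%:E * slanted_energy 0 u)%E /\
  (slanted_energy 0 u <= C%:E * \int[lebesgue3]_x (W 0 n v x)%:E)%E.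
Proof.
exact: (eq_ind_r (fun e => (\int[lebesgue3]_x (W 0 n v x)%:E <= C%:E * e)%E /\
  (e <= C%:E * \int[lebesgue3]_x (W 0 n v x)%:E)%E)
  (W_equiv 0 n (lexx 0)) (slanted0E n)).
Qed.

Let mG : measurable_fun (setT : set T3) (EFin \o G).
Proof. by apply/measurable_EFinP; exact: continuous_measurable_fun3. Qed.

Let C_gt0 : 0 < C.
Proof. by rewrite mulr_gt0 ?expR_gt0// divr_gt0// subr_gt0. Qed.

(** On the slab |x1| <= n + 1 the true and truncated surfaces coincide, so the energy there is
    bounded uniformly in [n]; monotone convergence over the slabs concludes. *)
Lemma slanted_energy_le : (slanted_energy v u <= C%:E * slanted_energy 0 u)%E.
Proof.
pose A (n : nat) : set T3 := [set x | `|coord1 x| <= n.+1%:R].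
have mA n : measurable (A n).
  have mf : measurable_fun (setT : set T3) (fun x : R3 R => `|coord1 x|).
    apply: continuous_measurable_fun3 => x.
    apply: (@continuous_comp _ _ _ (@coord1 R) Num.norm);
      first exact: continuous_coord1.
    exact: norm_continuous.
  have := mf measurableT _ (measurable_itv `]-oo, n.+1%:R] : measurable ([set`
    `]-oo, n.+1%:R]] : set R)).
  by rewrite setTI; congr measurable; apply/seteqP; split => x /=; rewrite in_itv.
have ndA : {homo A : n m / (n <= m)%N >-> (n <= m)%O}.
  move=> n m nm; apply/subsetPset => x /= /le_trans; apply.
  by rewrite ler_nat ltnS.
have UA : \bigcup_n A n = setT.
  apply/seteqP; split => // x _; exists (Num.truncn `|coord1 x|) => //.
  by rewrite /A /= ltW// truncnS_gt.
have cvA := @ge0_nondecreasing_set_cvg_integral _ _ _ A (EFin \o G) lebesgue3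
  ndA mA (fun n => measurable_funTS mG) (fun n x _ => G_ge0 x).
rewrite slantedE -[X in (X <=
  _)%E]/(\int[lebesgue3]_(x in setT) (EFin \o G) x)%E -UA.
rewrite -(cvg_lim _ cvA)//; apply: lime_le; first by apply/cvg_ex; eexists;
  exact: cvA.
apply: nearW => n.
have W_ge0 x : (0 <= (W 0 n v x)%:E)%E by rewrite lee_fin wedens_ge0.
have mW : measurable_fun (setT : set T3) (EFin \o W 0 n v).
  by have := measurable_int _ (int_W 0 n v v1).
apply: (@le_trans _ _ (\int[lebesgue3]_x (W 0 n v x)%:E)%E).
  have -> : (\int[lebesgue3]_(x in A n) (EFin \o G) x =
      \int[lebesgue3]_(x in A n) (W 0 n v x)%:E)%E.
    by apply: eq_integral => x; rewrite inE => xA; rewrite /= W_G.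
  exact: ge0_subset_integral.
exact: (W_equiv0 n).1.
Qed.

(** The truncated energy exceeds the true one by at most [n.+1%:R ^- 2] times the weighted energy,
    which the estimate with [k = 1] bounds by its value at t = 0, finite by the fast decay of
    [u]. *)
Lemma slanted_energy_ge : (slanted_energy 0 u <= C%:E * slanted_energy v u)%E.
Proof.
have z1 : `|0 : R| <= 1 by rewrite normr0.
(* Written with cutoff index 0, but by [W0E] it serves every [n]. *)
pose M := C * \int[lebesgue3]_x W 1 0 0 x.
have W1M n : (\int[lebesgue3]_x (W 1 n v x)%:E <= M%:E)%E.
  have [h _] := W_equiv 1 n ler01; apply: (le_trans h).
  rewrite /M (EFinM C) lee_pmul2l// EFin_Rintegral; last exact: int_W.
  rewrite le_eqVlt; apply/orP; left; apply/eqP; apply: eq_integral => x _.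
  exact: (congr1 EFin (etrans (W0E 1 n x) (esym (W0E 1 0 x)))).
have W_ge0 k n m x : 0 <= k -> (0 <= (W k n m x)%:E)%E.
  by move=> k0; rewrite lee_fin wedens_ge0.
have mW k n : measurable_fun (setT : set T3) (EFin \o W k n v).
  by have := measurable_int _ (int_W k n v v1).
have bound n : (slanted_energy 0 u <=
    C%:E * (slanted_energy v u + (n.+1%:R ^- 2 * M)%:E))%E.
  apply: (le_trans (W_equiv0 n).2).
  rewrite lee_pmul2l//.
  apply: (@le_trans _ _ (\int[lebesgue3]_x ((G x)%:E + (n.+1%:R ^- 2)%:E * (W 1
    n v x)%:E))%E).
    apply: ge0_le_integral => //.
    - by move=> x _; exact: W_ge0.
    - exact: mW.
    - by apply: emeasurable_funD => //; apply: measurable_funeM; exact: mW.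
    - by move=> x _; rewrite -EFinM -EFinD lee_fin G_W.
  rewrite ge0_integralD//; last 3 first.
  - by move=> x _; rewrite lee_fin G_ge0.
  - by move=> x _; apply: mule_ge0;
    [rewrite lee_fin invr_ge0 exprn_ge0|exact: W_ge0].
  - by apply: measurable_funeM; exact: mW.
  rewrite slantedE leeD2l// ge0_integralZl//; last 2 first.
  - exact: mW.
  - by move=> x _; exact: W_ge0.
  by rewrite EFinM lee_wpmul2l// lee_fin.
apply/lee_addgt0Pr => e e0.
(* This gives |C M| <= e (n + 1), and (n + 1) <= (n + 1)^2 makes the error at most [e]. *)
pose n := Num.truncn (`|C * M| / e).
apply: (le_trans (bound n)).
have nE : `|C * M| / e < n.+1%:R by exact: truncnS_gt.
(* The slanted energy may be infinite here; distributivity is legitimate because the other summand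
   is finite. *)
rewrite muleDr//; last exact: fin_num_adde_defl.
rewrite leeD2l// lee_fin.
have n1 : 1 <= n.+1%:R :> R by rewrite ler1n.
have n2 : 0 < n.+1%:R ^+ 2 :> R by rewrite exprn_gt0.
rewrite mulrCA ler_pdivrMl//.
move: nE; rewrite ltr_pdivrMr// => /ltW nE.
rewrite (le_trans (ler_norm _))// (le_trans nE)// ler_wpM2r ?(ltW e0)//.
by rewrite expr2 ler_peMr.
Qed.

End comparison.

Theorem theorem3p3 (R : realType) (v : R) (hv : `|v| < 1) (C0 : R) :
  exists C : R, 0 < C /\
  forall (V u : spacetime R -> R),
    smooth V ->
    smooth u -> fast_decay u ->
    solves_wave V u ->
    (forall (mu : R) (x : R3 R), 0 <= `|mu| -> `|mu| <= `|v| ->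
       `|V (x, mu * coord1 x)| <= C0 / japanese x ^+ 2) ->
    (slanted_energy v u <= C%:E * slanted_energy 0 u)%E /\
    (slanted_energy 0 u <= C%:E * slanted_energy v u)%E.
Proof.
(* The potential enters only through [C0], so one constant serves all V with the same bound; the
   absolute value is there because [C0] carries no sign condition. *)
exists (2 / (1 - `|v|) * expR ((9 * `|C0| + 2) / (1 - `|v|))); split.
  by rewrite mulr_gt0 ?expR_gt0// divr_gt0// subr_gt0.
move=> V u _ su du uV hV; split.
  exact: (slanted_energy_le u V v C0).
exact: (slanted_energy_ge u V v C0).
Qed.
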